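(* Let $1\le p_1,p_2\le\infty$ and $p_3\ge1$ be such that $\frac1{p_1}+\frac1{p_2}<\frac1{p_3}$. Then $\tilde{\mathcal M}_{(p_1,p_2,p_3)}(\mathbb R)=\{0\}$.
   Context: The Fourier transform is $\hat f(\xi)=\int_{\mathbb R}f(x)e^{-2\pi i x\xi}dx$. $\mathcal P(\mathbb R)$ denotes the set of Schwartz functions on $\mathbb R$ whose Fourier transform is continuous with compact support. For $1\le p_1,p_2\le\infty$, $0<p_3\le\infty$, $\tilde{\mathcal M}_{(p_1,p_2,p_3)}(\mathbb R)$ is the space of measurable (locally integrable) $M:\mathbb R\to\mathbb C$ such that the bilinear operator $B_M(f,g)(x)=\int_{\mathbb R}\int_{\mathbb R}\hat f(\xi)\hat g(\eta)M(\xi-\eta)e^{2\pi i(\xi+\eta)x}d\xi\,d\eta$, $f,g\in\mathcal P(\mathbb R)$, satisfies $\|B_M(f,g)\|_{p_3}\le C\|f\|_{p_1}\|g\|_{p_2}$ for some $C$ and all $f,g\in\mathcal P(\mathbb R)$. Functions equal almost everywhere are identified. *)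

(* Defs.v *)
From HB Require Import structures.
From mathcomp Require Import all_boot all_order all_algebra.
From mathcomp Require Import all_classical all_reals all_analysis.
From mathcomp Require Import complex.
Set Implicit Arguments. Unset Strict Implicit. Unset Printing Implicit Defensive.
Import Order.TTheory GRing.Theory Num.Theory.
Import numFieldNormedType.Exports.
Local Open Scope classical_set_scope.
Local Open Scope ring_scope.

Section Bilinear.
Variable R : realType.

Local Notation mu := (@lebesgue_measure R).
Local Notation C := (R[i]).

Definition cabs (z : C) : R := Num.sqrt (complex.Re z ^+ 2 + complex.Im z ^+ 2).

Definition cint (f : R -> C) : C :=
  Complex (Rintegral mu setT (fun x => complex.Re (f x)))
  (Rintegral mu setT (fun x => complex.Im (f x))).

Definition cexpi (t : R) : C := Complex (cos t) (sin t).

Definition fourier (f : R -> C) (xi : R) : C :=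
  cint (fun x => f x * cexpi (- (2 * pi * x * xi))).

Definition schwartz_real (u : R -> R) : Prop :=
  (forall (n : nat) (x : R), derivable (derive1n n u) x 1) /\
  (forall m n : nat, exists c : R, forall x : R, `|x| ^+ m * `|derive1n n u x| <= c).

Definition schwartz (f : R -> C) : Prop :=
  schwartz_real (fun x => complex.Re (f x)) /\
  schwartz_real (fun x => complex.Im (f x)).

Definition classP (f : R -> C) : Prop :=
  schwartz f /\
  continuous (fun xi => complex.Re (fourier f xi)) /\
  continuous (fun xi => complex.Im (fourier f xi)) /\
  exists K : R, forall xi : R, K < `|xi| -> fourier f xi = 0.

Definition Lpnorm (p : \bar R) (f : R -> C) : \bar R :=
  Lnorm mu p (fun x => (cabs (f x))%:E).

Definition bilin (M : R -> C) (f g : R -> C) (x : R) : C :=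
  cint (fun xi => cint (fun eta =>
    fourier f xi * fourier g eta * M (xi - eta) *
    cexpi (2 * pi * (xi + eta) * x))).

Definition measurable_c (M : R -> C) : Prop :=
  measurable_fun setT (fun x => complex.Re (M x)) /\
  measurable_fun setT (fun x => complex.Im (M x)).

Definition locally_integrable_c (M : R -> C) : Prop :=
  forall a b : R,
    mu.-integrable `[a, b] (fun x => (complex.Re (M x))%:E) /\
    mu.-integrable `[a, b] (fun x => (complex.Im (M x))%:E).

Definition Mtilde (p1 p2 p3 : \bar R) (M : R -> C) : Prop :=
  measurable_c M /\ locally_integrable_c M /\
  exists c : R, forall f g : R -> C, classP f -> classP g ->
    (Lpnorm p3 (bilin M f g) <= c%:E * (Lpnorm p1 f * Lpnorm p2 g))%E.

Definition inv_exp (p : \bar R) : R :=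
  match p with
  | r%:E => r^-1
  | _ => 0
  end.

End Bilinear.

(* Main.v *)
Require Import Defs.
From HB Require Import structures.
From mathcomp Require Import all_boot all_order all_algebra.
From mathcomp Require Import all_classical all_reals all_analysis.
From mathcomp Require Import measurable_realfun ess_sup_inf simple_functions.
From mathcomp Require Import complex ring lra.
Set Implicit Arguments. Unset Strict Implicit. Unset Printing Implicit Defensive.
Import Order.TTheory GRing.Theory Num.Theory.
Import numFieldNormedType.Exports.
Local Open Scope classical_set_scope.
Local Open Scope ring_scope.

                                                                               
                                                                               
                                                                              
                                                                    
                                                                         
                                                                               
                                                                                

                                                                              
                                                                    
                                                                                 
                                                               

                                    

(** Almost every [m] is a Lebesgue point of both real and imaginary parts of [M], so it is enough to
    show [M m = 0] at such a point. Suppose [M m <> 0] and test the inequality on two wave packets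
    of bandwidth [l]: [f = packet l m] with frequencies within [l] of [m], and [g = packet l 0] with
    frequencies within [l] of [0].

    Upper bound: a packet is bounded by a constant times [1 / (1 + (l x)^2)], so by scaling its norm
    in [L^p] is at most a constant times [l^(-1/p)] ([Lpnorm_packet]). Hence the right-hand side is
    at most a constant times [l^(-1/p1 - 1/p2)].

    Lower bound: the Fourier transforms are nonnegative windows of a fixed mass, and on their
    supports [xi - eta] stays within [2 l] of [m]. The Lebesgue point property makes [M (xi - eta)]
    close to [M m] on average. For [0 <= x <= d / l] with [d] small, the phase [(xi + eta) x]
    differs from [m x] by a small amount, so nothing cancels and the modulus of [bilin M f g x] is
    at least some [c > 0] independent of [l] ([bilin_packet_lower]). The left-hand side is therefore
    at least a constant times [l^(-1/p3)].

    Since [1/p1 + 1/p2 < 1/p3], letting [l] tend to [0] is contradictory ([Mtilde_lebesgue_pt_eq0]).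

    The packets are inverse transforms of rescaled bumps. Rather than through Fourier inversion,
    their transform is handled by Fejer summation: it is a rescaling of a function [profile], and
    the argument needs only that [profile] is continuous, nonnegative, supported in [[-1, 1]] and
    positive at [0]. *)

(** * Affine changes of variable for Lebesgue measure *)

Section Affine.
Variable R : realType.
Local Notation mu := (@lebesgue_measure R).
Implicit Types (a b : R).

Definition affine a b : measurableTypeR R -> measurableTypeR R :=
  fun x => a * x + b.

Lemma measurable_affine a b : measurable_fun setT (affine a b).
Proof. by apply: measurable_funD => //; apply: measurable_funM. Qed.

Let pushforward_mes a b : {measure set (measurableTypeR R) -> \bar R} :=
  measure_function_pushforward__canonical__measure_function_Measure mu (measurable_affine a b).

(** The right-hand side is itself a measure in [A], so by uniqueness of Lebesgue measure it suffices
    to compare lengths of half-open intervals. *)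
Lemma lebesgue_measure_affine a b (A : set R) : a != 0 -> measurable A ->
  mu A = (`|a|%:E * mu (affine a b @^-1` A))%E.
Proof.
move=> a0 mA.
pose m2 := mscale (NngNum (normr_ge0 a)) (pushforward_mes a b).
have -> : (`|a|%:E * mu (affine a b @^-1` A))%E = m2 A by [].
apply: lebesgue_measure_unique => // _ [[c d]] _ <-.
rewrite /m2.
have [ap|an|a00] := ltgtP a 0; last by rewrite a00 eqxx in a0.
(* For negative [a] the preimage reverses the interval, so the closed end moves to the left. *)
- rewrite [RHS](_ : _ = (`|a|%:E * mu `[((d - b) / a)%R, ((c - b) / a)%R[)%E); last first.
    congr (_ * mu _)%E.
    apply/seteqP; split => x /=; rewrite /affine !in_itv /= => /andP[h1 h2]; apply/andP; split.
    + by rewrite ler_ndivrMr//; lra.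
    + by rewrite ltr_ndivlMr//; lra.
    + by move: h2; rewrite ltr_ndivlMr//; lra.
    + by move: h1; rewrite ler_ndivrMr//; lra.
  rewrite !lebesgue_measure_itv /= !lte_fin ltr_nM2r ?invr_lt0// ltrD2r.
  case: ifP => _; last by rewrite mule0.
  rewrite -!EFinB -EFinM; congr (_%:E); rewrite ltr0_norm//.
  by field; rewrite lt_eqF.
- rewrite [RHS](_ : _ = (`|a|%:E * mu `]((c - b) / a)%R, ((d - b) / a)%R])%E); last first.
    congr (_ * mu _)%E.
    apply/seteqP; split => x /=; rewrite /affine !in_itv /= => /andP[h1 h2]; apply/andP; split.
    + by rewrite ltr_pdivrMr//; lra.
    + by rewrite ler_pdivlMr//; lra.
    + by move: h1; rewrite ltr_pdivrMr//; lra.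
    + by move: h2; rewrite ler_pdivlMr//; lra.
  rewrite !lebesgue_measure_itv /= !lte_fin ltr_pM2r ?invr_gt0// ltrD2r.
  case: ifP => _; last by rewrite mule0.
  rewrite -!EFinB -EFinM; congr (_%:E); rewrite gtr0_norm//.
  by field; rewrite gt_eqF.
Qed.

Lemma ge0_integral_affine a b (f : R -> \bar R) : a != 0 ->
  measurable_fun [set: R] f -> (forall x, 0 <= f x)%E ->
  (\int[mu]_x f (a * x + b)%R = `|a|^-1%:E * \int[mu]_x f x)%E.
Proof.
move=> a0 mf f0.
have an0 : `|a| != 0 by rewrite normr_eq0.
have -> : (\int[mu]_x f x = `|a|%:E * \int[pushforward_mes a b]_x f x)%E.
  rewrite -[X in (X%:E * _)%E]/((NngNum (normr_ge0 a))%:num).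
  rewrite -ge0_integral_mscale//; apply: eq_measure_integral => A mA _.
  exact: lebesgue_measure_affine.
rewrite ge0_integral_pushforward//; last exact: measurable_affine.
by rewrite muleA -EFinM mulVf// mul1e preimage_setT.
Qed.

Lemma integrable_affine a b (f : R -> R) : a != 0 ->
  mu.-integrable setT (EFin \o f) ->
  mu.-integrable setT (EFin \o (fun x => f (a * x + b))).
Proof.
move=> a0 /integrableP[mf fi]; apply/integrableP; split.
  by apply: (measurableT_comp mf); exact: measurable_affine.
rewrite (@ge0_integral_affine a b (fun x => `|(f x)%:E|%E))//; last first.
  exact: measurableT_comp.
by apply: lte_mul_pinfty; rewrite ?lee_fin// invr_ge0.
Qed.

Lemma Rintegral_affine a b (f : R -> R) : a != 0 ->
  mu.-integrable setT (EFin \o f) ->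
  \int[mu]_x f (a * x + b) = `|a|^-1 * \int[mu]_x f x.
Proof.
move=> a0 fi; have /integrableP[mf _] := fi.
rewrite /Rintegral [X in fine X = _]integralE [X in _ = _ * fine X]integralE.
have pos := @ge0_integral_affine a b ((EFin \o f)^\+)%E a0.
have neg := @ge0_integral_affine a b ((EFin \o f)^\-)%E a0.
rewrite [X in fine (X - _)](_ : _ = `|a|^-1%:E * \int[mu]_x (EFin \o f)^\+ x)%E; last first.
  rewrite -pos//; last exact: measurable_funepos.
  by apply: eq_integral => x _; rewrite !funeposE.
rewrite [X in fine (_ - X)](_ : _ = `|a|^-1%:E * \int[mu]_x (EFin \o f)^\- x)%E; last first.
  rewrite -neg//; last exact: measurable_funeneg.
  by apply: eq_integral => x _; rewrite !funenegE.
have p1 : (\int[mu]_x (EFin \o f)^\+ x \is a fin_num)%E by exact: integrable_pos_fin_num.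
have p2 : (\int[mu]_x (EFin \o f)^\- x \is a fin_num)%E by exact: integrable_neg_fin_num.
by rewrite -muleBr ?fin_num_adde_defr// fineM// fin_numB p1 p2.
Qed.

End Affine.

                     

(** * Smooth compactly supported bumps *)

Section Bump.
Variable R : realType.
Implicit Types (u v x : R).

Lemma is_derive1_comp_fun (f g : R -> R) (x a b : R) :
  is_derive (g x) 1 f a -> is_derive x 1 g b ->
  is_derive x 1 (fun y => f (g y)) (a * b).
Proof. by move=> df dg; exact: is_derive1_comp. Qed.

(** The classical function that is smooth but not analytic at [0]. The index [k] is carried along
    because differentiating [flat k] only produces combinations of [flat k.+1] and [flat k.+2]. *)
Definition flat (k : nat) (x : R) : R :=
  if 0 < x then x^-1 ^+ k * expR (- x^-1) else 0.

Lemma flat_le0 k x : x <= 0 -> flat k x = 0.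
Proof. by rewrite /flat ltNge => ->. Qed.

Lemma flat_ge0 k x : 0 <= flat k x.
Proof.
rewrite /flat; case: ifP => // x0.
by rewrite mulr_ge0 ?expR_ge0// exprn_ge0// invr_ge0 ltW.
Qed.

(** With [y = 1/x], the exponential series gives [y^(k+2) <= (k+2)! e^y]. Vanishing to second order
    is what makes [flat k] differentiable at [0] with derivative [0]. *)
Lemma flat_quadratic k x : `|flat k x| <= (k.+2)`!%:R * x ^+ 2.
Proof.
have [x0|x0] := lerP x 0.
  by rewrite flat_le0// normr0 mulr_ge0// sqr_ge0.
rewrite ger0_norm ?flat_ge0// /flat x0.
have xi : 0 < x^-1 by rewrite invr_gt0.
rewrite expRN ler_pdivrMr ?expR_gt0//.
have h : x^-1 ^+ k.+2 <= (k.+2)`!%:R * expR x^-1.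
  have := @expR_ge1Dxn R x^-1 k.+1 (ltW xi).
  rewrite -ler_pdivrMl ?ltr0n ?fact_gt0// mulrC => h1.
  by apply: (le_trans _ h1); rewrite lerDr.
have -> : x^-1 ^+ k = x ^+ 2 * x^-1 ^+ k.+2.
  by rewrite -(addn2 k) exprD mulrCA -[X in _ * X]exprMn mulfV ?gt_eqF// expr1n mulr1.
by rewrite [leRHS]mulrAC [leRHS]mulrC ler_wpM2l// sqr_ge0.
Qed.

Lemma is_derive_quadratic (f : R -> R) (c : R) :
  (forall x, `|f x| <= c * x ^+ 2) -> is_derive (0 : R) 1 f 0.
Proof.
move=> fc.
have f0 : f 0 = 0.
  by apply/normr0_eq0/eqP; rewrite eq_le normr_ge0 andbT (le_trans (fc 0))// expr0n mulr0.
have H : h^-1 *: ((f \o shift 0) (h *: 1) - f 0) @[h --> 0^'] --> (0 : R).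
  apply/cvgr0Pnorm_le => e e0.
  near=> h.
  have h0 : h != 0 by near: h; exact: nbhs_dnbhs_neq.
  rewrite /= f0 subr0 addr0 scaler1 normrZ normfV ler_pdivrMl ?normr_gt0//.
  apply: (le_trans (fc h)).
  rewrite -[h ^+ 2]real_normK ?num_real// expr2 mulrA mulrC ler_wpM2l//.
  rewrite (@le_trans _ _ (`|c| * `|h|))// ?ler_wpM2r// ?ler_norm//.
  have c1 : 0 < `|c| + 1 by rewrite ltr_wpDl.
  rewrite (@le_trans _ _ ((`|c| + 1) * `|h|))// ?ler_wpM2r// ?lerDl//.
  rewrite -ler_pdivlMl// mulrC.
  near: h; apply: dnbhs0_le; exact: divr_gt0.
apply: DeriveDef.
  by apply/cvg_ex; exists 0.
by rewrite /derive; apply/cvg_lim.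
Unshelve. all: end_near. Qed.

Lemma flat_is_derive k x :
  is_derive x 1 (flat k) (- k%:R * flat k.+1 x + flat k.+2 x).
Proof.
have [x0|x0|->] := ltgtP x 0.
- have -> : - k%:R * flat k.+1 x + flat k.+2 x = 0.
    by rewrite !flat_le0 ?ltW// mulr0 addr0.
  apply: (@near_eq_is_derive _ _ _ (cst 0)).
  near=> y; rewrite flat_le0//; apply/ltW; near: y.
  exact: lt_nbhsl.
- have xn : x != 0 by rewrite gt_eqF.
  apply: (@near_eq_is_derive _ _ _ (fun y : R => y^-1 ^+ k * expR (- y^-1))).
    near=> y; rewrite /flat ifT//; near: y.
    exact: lt_nbhsr.
  have dV : is_derive x 1 (fun y : R => y^-1) (- x ^- 2).
    by have := @is_deriveV R id x 1 1 xn _; rewrite /= scaler1; apply.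
  have dE : is_derive x 1 (fun y : R => expR (- y^-1)) (expR (- x^-1) * x ^- 2).
    have dN := is_deriveN dV; rewrite opprK in dN.
    exact: (is_derive1_comp_fun (is_derive_expR _) dN).
  have dX := is_deriveX k dV; rewrite exprfctE in dX.
  apply: (is_derive_eq (is_deriveM dX dE)).
  rewrite /flat x0 /=.
  rewrite {dX} /GRing.scale /= -exprVn.
  by case: k => [|k] /=; rewrite ?exprS ?expr0; ring.
- rewrite !flat_le0// mulr0 addr0.
  exact: is_derive_quadratic (flat_quadratic k).
Unshelve. all: end_near. Qed.

                                                                      
                                                                        
                         
Inductive bump_class : (R -> R) -> Prop :=
| BumpFlat j k : bump_class (fun u => flat j (1 + u) * flat k (1 - u))
| BumpAdd f g : bump_class f -> bump_class g -> bump_class (fun u => f u + g u)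
| BumpScale c f : bump_class f -> bump_class (fun u => c * f u)
| BumpMulX f : bump_class f -> bump_class (fun u => u * f u).

Lemma bump_supp f u : bump_class f -> 1 <= `|u| -> f u = 0.
Proof.
move=> + u1; elim => [j k|g h _ gE _ hE|c g _ gE|g _ gE]; last 3 first.
- by rewrite gE hE addr0.
- by rewrite gE mulr0.
- by rewrite gE mulr0.
- move: u1; rewrite ler_normr => /orP[u1|u1].
  + by rewrite [X in _ * X]flat_le0 ?mulr0//; lra.
  + by rewrite [X in X * _]flat_le0 ?mul0r//; lra.
Qed.

(** By induction on the class: for the generators this is the product rule with [flat_is_derive],
    the chain rule giving the sign in the factor in [1 - u]. *)
Lemma bump_derive f : bump_class f ->
  exists2 g, bump_class g & forall u, is_derive u 1 f (g u).
Proof.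
elim => [j k|f1 f2 _ [g1 b1 d1] _ [g2 b2 d2]|c f1 _ [g1 b1 d1]|f1 c1 [g1 b1 d1]].
- exists (fun u => (- j%:R * (flat j.+1 (1 + u) * flat k (1 - u))
                   + flat j.+2 (1 + u) * flat k (1 - u)) +
                   (k%:R * (flat j (1 + u) * flat k.+1 (1 - u))
                   + (- 1) * (flat j (1 + u) * flat k.+2 (1 - u)))).
    by repeat first [exact: BumpFlat | apply: BumpAdd | apply: BumpScale].
  move=> u.
  have dj : is_derive u 1 (fun u => flat j (1 + u))
     (- j%:R * flat j.+1 (1 + u) + flat j.+2 (1 + u)).
    have h1 : is_derive u 1 (fun u : R => 1 + u) 1.
      by have := is_deriveD (is_derive_cst (1 : R) u 1) (is_derive_id u 1); rewrite add0r.
    by have := @is_derive1_comp_fun (flat j) (fun u => 1 + u) _ _ _ (flat_is_derive j (1 + u)) h1; rewrite mulr1.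
  have dk : is_derive u 1 (fun u => flat k (1 - u))
     (- (- k%:R * flat k.+1 (1 - u) + flat k.+2 (1 - u))).
    have h1 : is_derive u 1 (fun u : R => 1 - u) (- 1).
      by have := is_deriveB (is_derive_cst (1 : R) u 1) (is_derive_id u 1); rewrite sub0r.
    by have := @is_derive1_comp_fun (flat k) (fun u => 1 - u) _ _ _ (flat_is_derive k (1 - u)) h1; rewrite mulrN1.
  apply: is_derive_eq; rewrite /GRing.scale /=; ring.
- exists (fun u => g1 u + g2 u); first exact: BumpAdd.
  by move=> u; apply: is_deriveD.
- exists (fun u => c * g1 u); first exact: BumpScale.
  by move=> u; apply: is_deriveZ.
- exists (fun u => f1 u + u * g1 u); first by apply: BumpAdd => //; exact: BumpMulX.
  move=> u; have := d1 u => d1u.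
  apply: is_derive_eq; rewrite /GRing.scale /=; ring.
Qed.

Lemma bump_continuous f : bump_class f -> continuous f.
Proof.
move=> /bump_derive[g _ fg] x; have := fg x => h.
apply: differentiable_continuous; apply/derivable1_diffP.
exact: ex_derive.
Qed.

(** This is [exp (- 2 / (1 - u^2))] on [(-1, 1)], extended by zero; it is even. *)
Definition mollifier : R -> R := fun u => flat 0 (1 + u) * flat 0 (1 - u).

Lemma mollifier_ge0 u : 0 <= mollifier u.
Proof. by rewrite mulr_ge0 ?flat_ge0. Qed.

End Bump.
Arguments mollifier {R} _.

                                                      

(** * A stability criterion for Schwartz functions *)

Section SchwartzClass.
Variable R : realType.

(** Every [x^m u^(n)] stays in [D], and members of [D] are bounded. *)
Lemma schwartz_class (D : (R -> R) -> Prop) :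
  (forall u, D u -> exists2 v, D v & forall x : R, is_derive x 1 u (v x)) ->
  (forall u, D u -> exists2 v, D v & forall x : R, x * u x = v x) ->
  (forall u, D u -> exists c, forall x, `|u x| <= c) ->
  forall u, D u -> schwartz_real u.
Proof.
move=> Dder Dmul Dbnd u Du.
have Dn n : D (derive1n n u).
  elim: n => // n /Dder[v Dv dv].
  rewrite derive1nS; suff -> : derive1 (derive1n n u) = v by [].
  by apply/funext => x; rewrite derive1E; have := dv x => dvx; rewrite derive_val.
split.
  by move=> n x; have [v _ dv] := Dder _ (Dn n); have := dv x => dvx; exact: ex_derive.
move=> m n; move: (derive1n n u) (Dn n); elim: m => [|m IHm] v Dv.
  by have [c vc] := Dbnd _ Dv; exists c => x; rewrite expr0 mul1r.
have [w Dw xv] := Dmul _ Dv.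
have [c wc] := IHm _ Dw; exists c => x.
by rewrite exprSr -mulrA -normrM xv.
Qed.

End SchwartzClass.

(** * Oscillatory integrals against a bump *)

Section Oscillatory.
Variable R : realType.
Local Notation mu := (@lebesgue_measure R).
Implicit Types (f g : R -> R) (th a l x u : R).

                                                                              
                                                                            
(** Here [a] is the carrier frequency and [l] the bandwidth. The offset [th] lets one real integral
    [osc] serve for cosine and sine alike: shifting [th] by [pi / 2] exchanges them, so real parts,
    imaginary parts and derivatives all keep the same form. *)
Definition phase th a l x u : R := 2 * pi * (a + l * u) * x + th.

Definition osc f th a l x : R :=
  \int[mu]_(u in `[(-1), 1]) (f u * cos (phase th a l x u)).

Lemma continuous_phase th a l x : continuous (phase th a l x).
Proof.
move=> u; rewrite /phase; apply: cvgD; last exact: cvg_cst.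
apply: cvgM; last exact: cvg_cst.
apply: cvgM; first exact: cvg_cst.
apply: cvgD; first exact: cvg_cst.
by apply: cvgM; [exact: cvg_cst | exact: cvg_id].
Qed.

Lemma continuous_integrable11 f : continuous f ->
  mu.-integrable `[(-1), 1] (EFin \o f).
Proof.
move=> cf; apply: continuous_compact_integrable; first exact: segment_compact.
exact: continuous_subspaceT.
Qed.

Lemma continuous_mul_cos f th a l x : continuous f ->
  continuous (fun u => f u * cos (phase th a l x u)).
Proof.
move=> cf u; apply: cvgM; first exact: cf.
apply: (@continuous_comp _ _ _ (phase th a l x) cos); first exact: continuous_phase.
exact: continuous_cos.
Qed.

Lemma continuous_mul_sin f th a l x : continuous f ->
  continuous (fun u => f u * sin (phase th a l x u)).
Proof.
move=> cf u; apply: cvgM; first exact: cf.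
apply: (@continuous_comp _ _ _ (phase th a l x) sin); first exact: continuous_phase.
exact: continuous_sin.
Qed.

Lemma cosDpi2 (y : R) : cos (y + pi / 2) = - sin y.
Proof. by rewrite cosD cos_pihalf sin_pihalf mulr0 mulr1 sub0r. Qed.

Lemma cosBpi2 (y : R) : cos (y - pi / 2) = sin y.
Proof. by rewrite cosB cos_pihalf sin_pihalf mulr0 mulr1 add0r. Qed.

Lemma osc_phaseN f th a l x : continuous f -> osc f (th + pi) a l x = - osc f th a l x.
Proof.
move=> cf; rewrite -mulN1r -RintegralZl//; last first.
  exact/continuous_integrable11/continuous_mul_cos.
apply: eq_Rintegral => u _; rewrite /phase addrA cosDpi; ring.
Qed.

(** The addition formula for cosine: a frequency shift by [b] is a modulation. *)
Lemma osc_shift f th a b l x : continuous f ->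
  osc f th (a + b) l x =
    cos (2 * pi * b * x) * osc f th a l x +
    sin (2 * pi * b * x) * osc f (th + pi / 2) a l x.
Proof.
move=> cf; rewrite -!RintegralZl//; try exact/continuous_integrable11/continuous_mul_cos.
rewrite -RintegralD//; last 2 first.
- apply: (continuous_integrable11 (f := fun u => _ * _)) => u.
  by apply: cvgM; [exact: cvg_cst|exact: continuous_mul_cos].
- apply: (continuous_integrable11 (f := fun u => _ * _)) => u.
  by apply: cvgM; [exact: cvg_cst|exact: continuous_mul_cos].
apply: eq_Rintegral => u _.
have -> : phase th (a + b) l x u = phase th a l x u + 2 * pi * b * x.
  by rewrite /phase; ring.
have -> : phase (th + pi / 2) a l x u = phase th a l x u + pi / 2.
  by rewrite /phase addrA.
rewrite cosDpi2 cosD; ring.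
Qed.

Lemma osc_scale f th a l s x : osc f th a l (s * x) = osc f th (a * s) (l * s) x.
Proof.
by apply: eq_Rintegral => u _; congr (_ * cos _); rewrite /phase; ring.
Qed.

Lemma osc_bound f th a l x : continuous f ->
  `|osc f th a l x| <= \int[mu]_(u in `[(-1), 1]) `|f u|.
Proof.
move=> cf; apply: le_trans.
  by apply: le_normr_Rintegral => //; exact/continuous_integrable11/continuous_mul_cos.
apply: le_Rintegral => //.
- apply: (continuous_integrable11 (f := fun u => `| _ |)) => u.
  by apply: cvg_norm; exact: continuous_mul_cos.
- apply: (continuous_integrable11 (f := fun u => `| _ |)) => u.
  by apply: cvg_norm; exact: cf.
- move=> u _; rewrite normrM ler_piMr//.
  by rewrite ler_norml cos_geN1 cos_le1.
Qed.

(** Differentiation under the integral sign. The factor [2 pi (a + l u)] comes from the phase, and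
    [- sin] is absorbed in the offset [pi / 2]; the absolute value of the new amplitude dominates
    uniformly in [x]. *)
Lemma osc_is_derive f th a l x : continuous f ->
  is_derive x 1 (osc f th a l)
    (osc (fun u => 2 * pi * (a + l * u) * f u) (th + pi / 2) a l x).
Proof.
move=> cf.
pose h y u := f u * cos (phase th a l y u).
pose w u := 2 * pi * (a + l * u) * f u.
have cw : continuous w.
  move=> u; apply: cvgM; last exact: cf.
  apply: cvgM; first exact: cvg_cst.
  apply: cvgD; first exact: cvg_cst.
  by apply: cvgM; [exact: cvg_cst|exact: cvg_id].
have dh (y u : R) : is_derive y 1 (h ^~ u) (w u * cos (phase (th + pi / 2) a l y u)).
  have dp : is_derive y 1 (fun y => phase th a l y u) (2 * pi * (a + l * u)).
    have := is_deriveD (is_deriveZ (2 * pi * (a + l * u)) (is_derive_id y (1 : R)))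
              (is_derive_cst th y (1 : R)).
    by rewrite addr0 /GRing.scale /= mulr1.
  have dc := @is_derive1_comp_fun _ cos (fun y => phase th a l y u) _ _ _ (is_derive_cos _) dp.
  apply: (is_derive_eq (is_deriveZ (f u) dc)).
  rewrite /phase addrA cosDpi2 -/(phase th a l y u) /w /GRing.scale /=; ring.
have I_x : `]x - 1, x + 1[%classic x.
  by rewrite /= in_itv /=; apply/andP; split; lra.
have hint y : `]x - 1, x + 1[%classic y -> mu.-integrable `[(-1), 1] (EFin \o h y).
  by move=> _; exact/continuous_integrable11/continuous_mul_cos.
have hder y u : `]x - 1, x + 1[%classic y -> `[(-1), 1]%classic u -> derivable (h ^~ u) y 1.
  by move=> _ _; have := dh y u => d; exact: ex_derive.
have wint : mu.-integrable `[(-1), 1] (EFin \o (fun u => `|w u|)).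
  by apply: continuous_integrable11 => u; apply: cvg_norm; exact: cw.
have d1E y u : partial1of2 h y u = w u * cos (phase (th + pi / 2) a l y u).
  by rewrite partial1of2E; have := dh y u => d; rewrite derive_val.
have hub y u : `]x - 1, x + 1[%classic y -> `[(-1), 1]%classic u -> `|partial1of2 h y u| <= `|w u|.
  move=> _ _; rewrite d1E normrM ler_piMr//.
  by rewrite ler_norml cos_geN1 cos_le1.
have mi : measurable (`[(-1), 1]%classic : set (measurableTypeR R)) by [].
apply: DeriveDef.
  exact: (derivable_under_integral mi I_x hint hder (fun u => normr_ge0 _) wint hub).
rewrite -derive1E (differentiation_under_integral mi I_x hint hder (fun u => normr_ge0 _) wint hub).
by apply: eq_Rintegral => u _; rewrite d1E.
Qed.

(** Integration by parts in [u]; the boundary terms vanish because [f] is zero at [-1] and [1]. *)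
Lemma osc_by_parts f g th a l x : bump_class f -> continuous g ->
  (forall u, is_derive u 1 f (g u)) ->
  2 * pi * l * x * osc f th a l x = - osc g (th - pi / 2) a l x.
Proof.
move=> bf cg df; have cf := bump_continuous bf.
pose F u := f u * sin (phase th a l x u).
(* [F'] is the derivative of [F], with the sine written as a cosine of offset [- pi / 2]; its
   integral over [[-1, 1]] is zero. *)
pose F' u := g u * cos (phase (th - pi / 2) a l x u) +
             2 * pi * l * x * (f u * cos (phase th a l x u)).
have dF u : is_derive u 1 F (F' u).
  have dp : is_derive u 1 (phase th a l x) (2 * pi * l * x).
    have := is_deriveD (is_deriveZ (2 * pi * l * x) (is_derive_id u (1 : R)))
              (is_derive_cst (2 * pi * a * x + th) u (1 : R)).
    rewrite addr0 /GRing.scale /= mulr1.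
    suff -> : phase th a l x = (2 * pi * l * x) \*: id + cst (2 * pi * a * x + th) by [].
    apply/funext => v; transitivity (2 * pi * l * x * v + (2 * pi * a * x + th)) => //.
    by rewrite /phase; ring.
  have dc := @is_derive1_comp_fun _ sin (phase th a l x) _ _ _ (is_derive_sin _) dp.
  have dfu := df u.
  apply: (is_derive_eq (is_deriveM dfu dc)).
  rewrite /F' [phase (_ - _) _ _ _ _]/phase addrA cosBpi2 -/(phase th a l x u) /GRing.scale /=; ring.
have cF' : continuous F'.
  move=> u; apply: cvgD; first exact: continuous_mul_cos.
  by apply: cvgM; [exact: cvg_cst|exact: continuous_mul_cos].
have cF : continuous F by exact: continuous_mul_sin.
have h11 : (-1 : R) < 1 by lra.
have : \int[mu]_(u in `[(-1), 1]) F' u = 0.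
  rewrite /Rintegral (@continuous_FTC2 _ F' F)//.
  - by rewrite /F !(bump_supp bf) ?normrN1 ?normr1// !mul0r sube0.
  - exact: continuous_subspaceT.
  - split.
    + by move=> u _; have := dF u => d; exact: ex_derive.
    + by apply: cvg_at_right_filter; exact: cF.
    + by apply: cvg_at_left_filter; exact: cF.
  - by move=> u _; rewrite derive1E; have := dF u => d; rewrite derive_val.
rewrite RintegralD//; last 2 first.
- exact/continuous_integrable11/continuous_mul_cos.
- apply: (continuous_integrable11 (f := fun u => _ * (_ * _))) => u.
  by apply: cvgM; [exact: cvg_cst|exact: continuous_mul_cos].
rewrite RintegralZl//; last exact/continuous_integrable11/continuous_mul_cos.
by rewrite -!/(osc _ _ _ _ _) => /eqP; rewrite addrC addr_eq0 => /eqP.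
Qed.

(** For fixed [a] and [l], the functions [osc g t a l] with [g] in the bump class satisfy
    [schwartz_class]: derivatives come from [osc_is_derive], multiplication by [x] from
    [osc_by_parts] divided by [2 pi l], boundedness from [osc_bound]. *)
Lemma osc_schwartz f th a l : l != 0 -> bump_class f ->
  schwartz_real (osc f th a l).
Proof.
move=> l0 bf.
pose D (u : R -> R) := exists2 g, bump_class g & exists t, u = osc g t a l.
apply: (@schwartz_class R D); last by exists f => //; exists th.
- move=> _ [g bg [t ->]].
  exists (osc (fun u => 2 * pi * (a + l * u) * g u) (t + pi / 2) a l).
    exists (fun u => 2 * pi * (a + l * u) * g u); last by exists (t + pi / 2).
    rewrite (_ : (fun u => _) = (fun u => (2 * pi * a) * g u + (2 * pi * l) * (u * g u))).
      by apply: BumpAdd; apply: BumpScale => //; exact: BumpMulX.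
    by apply/funext => u; ring.
  by move=> x; exact/osc_is_derive/bump_continuous.
- move=> _ [g bg [t ->]].
  have [g' bg' dg] := bump_derive bg.
  exists (osc (fun u => - (2 * pi * l)^-1 * g' u) (t - pi / 2) a l).
    exists (fun u => - (2 * pi * l)^-1 * g' u); last by exists (t - pi / 2).
    exact: BumpScale.
  move=> x; have := @osc_by_parts _ _ t a l x bg (bump_continuous bg') dg.
  have pl : 2 * pi * l != 0 by rewrite !mulf_neq0// gt_eqF// pi_gt0.
  have -> : osc (fun u => - (2 * pi * l)^-1 * g' u) (t - pi / 2) a l x =
     - (2 * pi * l)^-1 * osc g' (t - pi / 2) a l x.
    rewrite -RintegralZl//; last first.
      exact/continuous_integrable11/continuous_mul_cos/bump_continuous.
    by apply: eq_Rintegral => u _; rewrite mulrA.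
  by move=> h; apply: (mulfI pl); rewrite mulrA h mulrA mulrN divff// mulN1r.
- move=> _ [g bg [t ->]]; exists (\int[mu]_(u in `[(-1), 1]) `|g u|) => x.
  exact/osc_bound/bump_continuous.
Qed.

(** Two integrations by parts bound [(l x)^2] times the integral by the [L^1] norm of the second
    derivative. The point is that [K] does not depend on [th], [a] or [l]. *)
Lemma osc_decay f : bump_class f -> exists2 K : R, 0 < K &
  forall th a l x, `|osc f th a l x| <= K / (1 + (l * x) ^+ 2).
Proof.
move=> bf; have [g bg dg] := bump_derive bf; have [h bh dh] := bump_derive bg.
pose N (k : R -> R) := \int[mu]_(u in `[(-1), 1]) `|k u|.
have N0 (k : R -> R) : 0 <= N k by apply: Rintegral_ge0 => u _.
(* [h] is the second derivative of [f]; the summand [1] serves to make the constant strictly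
   positive. *)
exists (N f + N h + 1); first by rewrite ltr_wpDl// addr_ge0.
move=> th a l x.
have y0 : 0 < 1 + (l * x) ^+ 2 by rewrite ltr_pwDl// sqr_ge0.
rewrite ler_pdivlMr// mulrDr mulr1.
have p1 : 1 <= (2 * pi) ^+ 2 :> R.
  have := @pi_ge2 R; move=> p2; rewrite expr_ge1//; lra.
have H : (2 * pi) ^+ 2 * ((l * x) ^+ 2 * osc f th a l x) = osc h (th - pi / 2 - pi / 2) a l x.
  have e1 := @osc_by_parts _ _ th a l x bf (bump_continuous bg) dg.
  have e2 := @osc_by_parts _ _ (th - pi / 2) a l x bg (bump_continuous bh) dh.
  rewrite -[RHS]opprK -e2.
  have -> : osc g (th - pi / 2) a l x = - (2 * pi * l * x * osc f th a l x) by rewrite e1 opprK.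
  ring.
have b1 := @osc_bound f th a l x (bump_continuous bf).
have b2 := @osc_bound h (th - pi / 2 - pi / 2) a l x (bump_continuous bh).
rewrite -addrA lerD//.
rewrite (@le_trans _ _ (N h))// ?lerDl//.
apply: (le_trans _ b2); rewrite -H mulrA normrM (ger0_norm (mulr_ge0 (sqr_ge0 _) (sqr_ge0 _))).
by rewrite mulrC ler_wpM2r// ler_peMl// sqr_ge0.
Qed.

End Oscillatory.

                                    

(** * Fubini for real-valued integrals *)

Section ProductIntegral.
Variable R : realType.
Local Notation mu := (@lebesgue_measure R).
Local Notation mu2 := (product_measure1 mu mu).

Lemma measurable_prod_mul (f g : R -> R) :
  measurable_fun setT f -> measurable_fun setT g ->
  measurable_fun setT (fun z : measurableTypeR R * measurableTypeR R => f z.1 * g z.2).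
Proof.
by move=> mf mg; apply: measurable_funM;
  [exact: (measurableT_comp mf measurable_fst)|exact: (measurableT_comp mg measurable_snd)].
Qed.

Lemma ge0_integral_prod_mul (f g : R -> R) :
  measurable_fun setT f -> measurable_fun setT g ->
  (forall x, 0 <= f x) -> (forall x, 0 <= g x) ->
  (\int[mu]_x \int[mu]_y (f x * g y)%:E =
    (\int[mu]_x (f x)%:E) * (\int[mu]_y (g y)%:E))%E.
Proof.
move=> mf mg f0 g0.
under eq_integral => x _.
  under eq_integral do rewrite EFinM.
  rewrite ge0_integralZl_EFin//; last 2 first.
    by move=> y _; rewrite lee_fin.
    exact/measurable_EFinP.
  over.
rewrite ge0_integralZr//.
- exact/measurable_EFinP.
- by move=> x _; rewrite lee_fin.
- by apply: integral_ge0 => y _; rewrite lee_fin.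
Qed.

Lemma integrable_prod_mul (f g : R -> R) :
  mu.-integrable setT (EFin \o f) -> mu.-integrable setT (EFin \o g) ->
  mu2.-integrable setT (EFin \o (fun z => f z.1 * g z.2)).
Proof.
move=> /integrableP[/measurable_EFinP mf fi] /integrableP[/measurable_EFinP mg gi].
apply/integrable12ltyP.
  by apply/measurable_EFinP; apply: measurable_prod_mul.
under eq_integral do under eq_integral do rewrite /= normrM.
rewrite (@ge0_integral_prod_mul (fun x => `|f x|) (fun x => `|g x|))//.
- by apply: lte_mul_pinfty => //; [exact: integral_ge0|rewrite ge0_fin_numE ?integral_ge0].
- exact: measurableT_comp.
- exact: measurableT_comp.
Qed.

(** A real-valued inner integral replaces an infinite value by [0] through [fine]. Integrability
    makes the inner integral finite almost everywhere, so the outer integral is unchanged. *)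
Lemma Rintegral_prod (f : R * R -> R) : mu2.-integrable setT (EFin \o f) ->
  \int[mu2]_z f z = \int[mu]_x \int[mu]_y f (x, y).
Proof.
move=> fi; rewrite /Rintegral -(integral12_prod_meas1 fi).
congr fine; apply: ae_eq_integral => //.
- exact: measurable_fubini_F fi.
- apply/measurable_EFinP; apply: (@measurableT_comp _ _ _ _ _ _ fine) => //.
  exact: measurable_fubini_F fi.
have /integrable_ae := integrable_fubini_F fi.
move=> /(_ measurableT); apply: filterS => x h _.
by rewrite /fubini_F /= fineK//; exact: h.
Qed.

Lemma Rintegral_swap (f : R * R -> R) : mu2.-integrable setT (EFin \o f) ->
  \int[mu]_x \int[mu]_y f (x, y) = \int[mu]_y \int[mu]_x f (x, y).
Proof.
move=> fi; rewrite -Rintegral_prod// /Rintegral -(integral21_prod_meas1 fi).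
congr fine; apply: ae_eq_integral => //.
- exact: measurable_fubini_G fi.
- apply/measurable_EFinP; apply: (@measurableT_comp _ _ _ _ _ _ fine) => //.
  exact: measurable_fubini_G fi.
have := ae_integrable2 fi; apply: filterS => y h _.
by rewrite /fubini_G /= fineK//; exact: integrable_fin_num h.
Qed.

Lemma Rintegral_prod_mul (f g : R -> R) :
  mu.-integrable setT (EFin \o f) -> mu.-integrable setT (EFin \o g) ->
  \int[mu2]_z (f z.1 * g z.2) = (\int[mu]_x f x) * (\int[mu]_y g y).
Proof.
move=> fi gi; rewrite (Rintegral_prod (integrable_prod_mul fi gi))/=.
by under eq_Rintegral do rewrite RintegralZl//; rewrite RintegralZr.
Qed.

End ProductIntegral.

(** * The Fejer kernel on the line *)

Section Fejer.
Variable R : realType.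
Local Notation mu := (@lebesgue_measure R).
Implicit Types (N t x : R).

Lemma integrable_oneDsqrV : mu.-integrable setT (EFin \o (fun x => (1 + x ^+ 2)^-1)).
Proof.
have m1 : measurable_fun setT (fun x : R => (1 + x ^+ 2)^-1).
  by apply: continuous_measurable_fun; exact: continuous_oneDsqrV.
have p x : 0 <= (1 + x ^+ 2)^-1 by rewrite invr_ge0 addr_ge0// sqr_ge0.
apply/integrableP; split; first exact/measurable_EFinP.
under eq_integral do rewrite /= ger0_norm//.
rewrite ge0_symfun_integralT//.
- rewrite (_ : [set x | _] = `[0, +oo[%classic); last first.
    by apply/seteqP; split => x/=; rewrite in_itv/= andbT.
  by have := @integral0y_oneDsqr R; rewrite /oneDsqr => ->; rewrite -EFinM ltry.
- exact: continuous_oneDsqrV.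
- by move=> x /=; rewrite sqrrN.
Qed.

(** The tent of half-width [N]. It serves as a summation cutoff because its cosine transform
    [fejer_kernel] is nonnegative. *)
Definition fejer N x : R := Num.max 0 (1 - `|x| / N).

Lemma fejer_ge0 N x : 0 <= fejer N x.
Proof. by rewrite le_max lexx. Qed.

Lemma fejer_le1 N x : 0 < N -> fejer N x <= 1.
Proof.
move=> N0; rewrite ge_max ler01 lerBlDr lerDl.
by rewrite divr_ge0// ltW.
Qed.

Lemma continuous_fejer N : continuous (fejer N).
Proof.
have -> : fejer N = (fun x => ((1 - `|x| / N) + `|1 - `|x| / N|) / 2).
  apply/funext => x; rewrite /fejer; move: (1 - _) => y; case: leP => h.
    by rewrite (ger0_norm h); field.
  by rewrite (ltr0_norm h) subrr mul0r.
have cf : continuous (fun x : R => 1 - `|x| / N).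
  move=> x; apply: cvgB; first exact: cvg_cst.
  by apply: cvgM; [apply: cvg_norm; exact: cvg_id|exact: cvg_cst].
move=> x; apply: cvgM; last exact: cvg_cst.
by apply: cvgD; [exact: cf|apply: cvg_norm; exact: cf].
Qed.

Lemma fejer_out N x : 0 < N -> N <= `|x| -> fejer N x = 0.
Proof.
move=> N0 Nx; apply/max_idPl; rewrite subr_le0 ler_pdivlMr// mul1r//.
Qed.

Lemma fejer_mid N x : 0 < N -> `|x| <= N / 2 -> 2^-1 <= fejer N x.
Proof.
move=> N0 Nx; rewrite le_max; apply/orP; right.
have : `|x| / N <= 2^-1 by rewrite ler_pdivrMr// mulrC.
lra.
Qed.

Lemma integrable_fejer N : 0 < N -> mu.-integrable setT (EFin \o fejer N).
Proof.
move=> N0.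
have -> : EFin \o fejer N = (EFin \o fejer N) \_ `[- N, N].
  apply/funext => x; rewrite patchE; case: ifPn => //.
  rewrite notin_setE /= in_itv /= => /negP h; rewrite fejer_out//.
  by move: h; rewrite -ler_norml -ltNge => /ltW.
have mi : measurable (`[- N, N]%classic : set (measurableTypeR R)) by [].
apply/(integrable_mkcond _ mi).1.
apply: continuous_compact_integrable; first exact: segment_compact.
by apply: continuous_subspaceT; exact: continuous_fejer.
Qed.

Definition fejer_kernel N t : R := \int[mu]_x (fejer N x * cos (2 * pi * t * x)).

Lemma continuous_cosM t : continuous (fun x : R => cos (t * x)).
Proof.
move=> x; apply: (@continuous_comp _ _ _ (fun x => t * x) cos).
  by apply: cvgM; [exact: cvg_cst|exact: cvg_id].
exact: continuous_cos.
Qed.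

Lemma integrable_fejer_cos N t : 0 < N ->
  mu.-integrable setT (EFin \o (fun x => fejer N x * cos (t * x))).
Proof.
move=> N0; apply: (le_integrable _ _ _ (integrable_fejer N0)) => //.
  apply/measurable_EFinP; apply: continuous_measurable_fun => x.
  by apply: cvgM; [exact: continuous_fejer|exact: continuous_cosM].
move=> x _; rewrite /= lee_fin normrM ler_piMr//.
by rewrite ler_norml cos_geN1 cos_le1.
Qed.

(** Both positivity and the decay in [N t^2] are read off this closed form. *)
Lemma fejer_kernelE N t : 0 < N -> t != 0 ->
  fejer_kernel N t = 2 * (1 - cos (2 * pi * t * N)) / (N * (2 * pi * t) ^+ 2).
Proof.
move=> N0 t0; rewrite /fejer_kernel.
have w0 : 2 * pi * t != 0 by rewrite !mulf_neq0// gt_eqF// pi_gt0.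
move: (2 * pi * t) w0 => w w0.
have Nn : N != 0 by rewrite gt_eqF.
have ck : continuous (fun x => fejer N x * cos (w * x)).
  by move=> x; apply: cvgM; [exact: continuous_fejer|exact: continuous_cosM].
have intN (a b : R) : mu.-integrable `[a, b] (EFin \o (fun x => fejer N x * cos (w * x))).
  by apply: integrableS (integrable_fejer_cos w N0).
have -> : \int[mu]_x (fejer N x * cos (w * x)) =
    \int[mu]_(x in `[- N, N]) (fejer N x * cos (w * x)).
  rewrite [RHS]Rintegral_mkcond; apply: eq_Rintegral => x _.
  rewrite patchE; case: ifPn => //.
  rewrite notin_setE /= in_itv /= => /negP h; rewrite fejer_out ?mul0r//.
  by move: h; rewrite -ler_norml -ltNge => /ltW.
(* An antiderivative on each side of the tent: [s = 1] on [[0, N]] and [s = -1] on [[-N, 0]]. *)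
pose F (s x : R) := (1 - s * x / N) * (sin (w * x) / w) - s * cos (w * x) / (N * w ^+ 2).
have dF s x : is_derive x 1 (F s) ((1 - s * x / N) * cos (w * x)).
  have dw : is_derive x 1 (fun x => w * x) w.
    by have := is_deriveZ w (is_derive_id x (1 : R)); rewrite /GRing.scale /= mulr1.
  have dc := @is_derive1_comp_fun _ cos (fun x => w * x) _ _ _ (is_derive_cos _) dw.
  have ds := @is_derive1_comp_fun _ sin (fun x => w * x) _ _ _ (is_derive_sin _) dw.
  have dl : is_derive x 1 (fun x => 1 - s * x / N) (- (s / N)).
    have := is_deriveB (is_derive_cst (1 : R) x 1) (is_deriveZ (s / N) (is_derive_id x (1 : R))).
    rewrite sub0r /GRing.scale /= mulr1.
    suff -> : (fun x => 1 - s * x / N) = cst 1 - (s / N) \*: id by [].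
    by apply/funext => y; transitivity (1 - (s / N) * y) => //; ring.
  have d1 := is_deriveM dl (is_deriveZ w^-1 ds).
  have d2 := is_deriveZ (s / (N * w ^+ 2)) dc.
  have d3 := is_deriveB d1 d2.
  have -> : F s = (fun x => 1 - s * x / N) * (w^-1 \*: (fun x => sin (w * x))) -
      (s / (N * w ^+ 2)) \*: (fun x => cos (w * x)).
    apply/funext => y; rewrite /F.
    transitivity ((1 - s * y / N) * (w^-1 * sin (w * y)) - (s / (N * w ^+ 2)) * cos (w * y)) => //.
    ring.
  apply: (is_derive_eq d3).
  transitivity ((1 - s * x / N) * (w^-1 * (cos (w * x) * w)) +
    (w^-1 * sin (w * x)) * - (s / N) - (s / (N * w ^+ 2)) * (- sin (w * x) * w)) => //.
  field.
  by rewrite Nn w0.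
have FTC s a b : a < b -> (forall x, x \in `[a, b] -> fejer N x = 1 - s * x / N) ->
    \int[mu]_(x in `[a, b]) (fejer N x * cos (w * x)) = F s b - F s a.
  move=> ab sE; have cF : continuous (F s).
    by move=> x; apply: differentiable_continuous; apply/derivable1_diffP;
      have := dF s x => d; exact: ex_derive.
  rewrite /Rintegral (@continuous_FTC2 _ _ (F s))//.
  - exact: continuous_subspaceT.
  - split.
    + by move=> x _; have := dF s x => d; exact: ex_derive.
    + by apply: cvg_at_right_filter; exact: cF.
    + by apply: cvg_at_left_filter; exact: cF.
  - move=> x xab; rewrite derive1E; have := dF s x => d; rewrite derive_val sE//.
    exact: subset_itv_oo_cc.
have NN : - N < N by lra.
have -> : \int[mu]_(x in `[- N, N]) (fejer N x * cos (w * x)) =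
    \int[mu]_(x in `[- N, 0]) (fejer N x * cos (w * x)) +
    \int[mu]_(x in `[0, N]) (fejer N x * cos (w * x)).
  have := @Rintegral_itvB _ (fun x => fejer N x * cos (w * x)) (BLeft (- N)) (BRight N) 0 (intN _ _).
  rewrite !bnd_simp => /(_ _ _)/eqP; rewrite subr_eq => h.
  rewrite (eqP (h _ _)) ?ltW ?oppr_lt0// addrC; congr (_ + _).
  by rewrite Rintegral_itv_obnd_cbnd//; apply: integrableS (intN 0 N) => //; exact: subset_itv_oc_cc.
rewrite (FTC (-1)) ?(FTC 1) ?oppr_lt0//; last 2 first.
- move=> x; rewrite in_itv /= => /andP[x0 xN].
  rewrite /fejer ger0_norm// mul1r; apply/max_idPr.
  by rewrite subr_ge0 ler_pdivrMr// mul1r.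
- move=> x; rewrite in_itv /= => /andP[x0 xN].
  rewrite /fejer ler0_norm// mulN1r; apply/max_idPr.
  by rewrite subr_ge0 ler_pdivrMr// mul1r; lra.
rewrite /F !mulr0 (mulrN w N) cosN sinN cos0 sin0; field.
by rewrite Nn w0.
Qed.

Lemma fejer_kernel_ge0 N t : 0 < N -> 0 <= fejer_kernel N t.
Proof.
move=> N0; have [->|t0] := eqVneq t 0.
  apply: Rintegral_ge0 => x _; rewrite mulr0 mul0r cos0 mulr1; exact: fejer_ge0.
rewrite fejer_kernelE//; apply: divr_ge0; last by rewrite mulr_ge0 ?sqr_ge0// ltW.
by have := cos_le1 (2 * pi * t * N); lra.
Qed.

(** The numerator [2 (1 - cos)] is at most [4], while [(2 pi)^2] is at least [16]. *)
Lemma fejer_kernel_le N t : 0 < N -> t != 0 -> fejer_kernel N t <= (N * t ^+ 2)^-1.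
Proof.
move=> N0 t0; rewrite fejer_kernelE//.
have w0 : 0 < (2 * pi * t) ^+ 2 by rewrite exprn_even_gt0//= !mulf_neq0// gt_eqF// pi_gt0.
have t2 : 0 < t ^+ 2 by rewrite exprn_even_gt0.
rewrite ler_pdivrMr; last exact: mulr_gt0.
have -> : (N * t ^+ 2)^-1 * (N * (2 * pi * t) ^+ 2) = (2 * pi) ^+ 2.
  by rewrite [in LHS]exprMn; move: (2 * pi) => q; field; rewrite t0 gt_eqF.
have p2 := @pi_ge2 R; have c1 := cos_geN1 (2 * pi * t * N).
have : 4 * 4 <= (2 * pi) ^+ 2 :> R by rewrite expr2 ler_pM//; lra.
lra.
Qed.

Lemma cos_near0 : exists2 d : R, 0 < d & forall x, `|x| <= d -> 2^-1 <= cos x.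
Proof.
have /cvgrPdist_le/(_ 2^-1) := @continuous_cos R 0.
case=> [|d /= d0]; first by [].
rewrite cos0 => h.
exists (d / 2); first by rewrite divr_gt0.
move=> x xd; have := h x; rewrite /= sub0r normrN => /(_ _).
have xd' : `|x| < d by apply: (le_lt_trans xd); lra.
by move=> /(_ xd'); rewrite ler_norml => /andP[_]; lra.
Qed.

(** For such [t] the cosine is at least [1/2] on the whole support of the tent, and the tent is at
    least [1/2] on [[0, N/2]]; hence the integral is at least [1/4 * N/2]. *)
Lemma fejer_kernel_near0 : exists2 d : R, 0 < d &
  forall N t, 0 < N -> `|t| <= d / N -> N / 8 <= fejer_kernel N t.
Proof.
have [d d0 hd] := cos_near0.
have pp := @pi_gt0 R.
exists (d / (2 * pi)); first by rewrite divr_gt0// mulr_gt0.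
move=> N t N0 tN.
have itvm : measurable (`[0, N / 2]%classic : set (measurableTypeR R)) by [].
have -> : N / 8 = \int[mu]_x ((4^-1 : R) * \1_(`[0, N / 2]%classic : set R) x).
  rewrite RintegralZl//; last exact: integrable_indic_itv.
  rewrite /Rintegral integral_indic// setIT /= lebesgue_measure_itv/= lte_fin ifT; last by lra.
  by rewrite oppr0 /= addr0; field.
apply: le_Rintegral => //.
- under [X in _.-integrable _ X]eq_fun do rewrite /= EFinM.
  by apply: integrableZl => //; exact: integrable_indic_itv.
- exact: integrable_fejer_cos.
move=> x _.
have hc : `|x| <= N -> 2^-1 <= cos (2 * pi * t * x).
  move=> xN; apply: hd; rewrite !normrM (ger0_norm (ltW pp)) ger0_norm//.
  rewrite (@le_trans _ _ (2 * pi * (d / (2 * pi) / N) * N))//.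
    by rewrite ler_pM ?mulr_ge0// ?ler_pM2l ?mulr_gt0// ltW.
  have : 2 * pi != 0 :> R by rewrite gt_eqF// mulr_gt0.
  move: (2 * pi) => q q0; rewrite le_eqVlt; apply/orP; left; apply/eqP; field.
  by rewrite q0 gt_eqF.
have [xN|xN] := leP `|x| N; last first.
  rewrite (fejer_out N0 (ltW xN)) mul0r indicE memNset ?mulr0//.
  by rewrite /= in_itv /= => /andP[x0 x1]; move: xN; rewrite ger0_norm//; lra.
have {}hc := hc xN.
rewrite indicE; have [|_] := boolP (x \in _); last first.
  by rewrite mulr0 mulr_ge0 ?fejer_ge0//; lra.
rewrite inE /= in_itv /= => /andP[x0 x1]; rewrite mulr1.
have f2 : 2^-1 <= fejer N x by apply: fejer_mid => //; rewrite ger0_norm.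
rewrite (@le_trans _ _ (2^-1 * 2^-1))//; first by lra.
by rewrite ler_pM.
Qed.

End Fejer.

Section FubiniIntegrable.
Variable R : realType.
Local Notation mu := (@lebesgue_measure R).
Local Notation mu2 := (product_measure1 mu mu).

Lemma integrable_Rintegral_prod (f : R * R -> R) :
  mu2.-integrable setT (EFin \o f) ->
  (forall x, mu.-integrable setT (EFin \o (fun y => f (x, y)))) ->
  mu.-integrable setT (EFin \o (fun x => \int[mu]_y f (x, y))).
Proof.
move=> fi fxi; apply: eq_integrable (integrable_fubini_F fi) => // x _.
by rewrite /fubini_F /= fineK//; exact: integrable_fin_num (fxi x).
Qed.

End FubiniIntegrable.

Lemma ler_cvgn (R : realType) (u v : nat -> R) (a b : R) :
  u n @[n --> \oo] --> a -> v n @[n --> \oo] --> b -> (forall n, u n <= v n) -> a <= b.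
Proof.
move=> ua vb uv; rewrite -(cvg_lim (@Rhausdorff R) ua) -(cvg_lim (@Rhausdorff R) vb).
by apply: ler_lim; [exact: cvgP ua|exact: cvgP vb|exact: nearW].
Qed.

                                                  

(** * The transform of the mollifier, studied by Fejer summation *)

Section Profile.
Variable R : realType.
Local Notation mu := (@lebesgue_measure R).
Local Notation mu2 := (product_measure1 mu mu).
Implicit Types (f : R -> R) (th a l s x u N : R).

Lemma mollifierP : bump_class (@mollifier R).
Proof. exact: (BumpFlat R 0 0). Qed.

Lemma continuous_mollifier : continuous (@mollifier R).
Proof. exact: bump_continuous mollifierP. Qed.

Lemma continuous_osc f th a l : continuous f -> continuous (osc f th a l).
Proof.
move=> cf x; apply: differentiable_continuous; apply/derivable1_diffP.
by have := osc_is_derive th a l x cf => d; exact: ex_derive.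
Qed.

Lemma integrable_oneDsqrVM l : l != 0 ->
  mu.-integrable setT (EFin \o (fun x => (1 + (l * x) ^+ 2)^-1)).
Proof.
move=> l0; have := integrable_affine 0 l0 (@integrable_oneDsqrV R).
by under eq_fun do rewrite addr0.
Qed.

Lemma integrable_osc f th a l : bump_class f -> l != 0 ->
  mu.-integrable setT (EFin \o osc f th a l).
Proof.
move=> bf l0; have [K K0 hK] := osc_decay bf.
have hi : mu.-integrable setT (EFin \o (fun x => K * (1 + (l * x) ^+ 2)^-1)).
  under [X in _.-integrable _ X]eq_fun do rewrite /= EFinM.
  by apply: integrableZl => //; exact: integrable_oneDsqrVM.
apply: (le_integrable _ _ _ hi) => //.
  apply/measurable_EFinP; apply: continuous_measurable_fun.
  exact/continuous_osc/bump_continuous.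
by move=> x _; rewrite /= lee_fin (le_trans (hK th a l x))// ler_norm.
Qed.

                                                                                 
                                         
(** By Fourier inversion this equals [mollifier s]. The lemmas below obtain its continuity, sign,
    support and positivity at [0] directly. *)
Definition profile s : R := \int[mu]_x osc mollifier 0 s 1 x.

(** With this offset the integrand is a sine integral, odd in [x]. This is why the transform of a
    packet is real. *)
Lemma integral_osc_odd s : \int[mu]_x osc mollifier (- (pi / 2)) s 1 x = 0.
Proof.
have i1 := @integrable_osc _ (- (pi / 2)) s 1 mollifierP (oner_neq0 _).
have m1 : -1 != 0 :> R by rewrite oppr_eq0 oner_eq0.
have := Rintegral_affine 0 m1 i1.
rewrite normrN1 invr1 mul1r.
have -> : \int[mu]_x osc mollifier (- (pi / 2)) s 1 (-1 * x + 0) =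
          \int[mu]_x (-1 * osc mollifier (- (pi / 2)) s 1 x).
  apply: eq_Rintegral => x _.
  rewrite /osc -RintegralZl//; last first.
    exact/continuous_integrable11/continuous_mul_cos/continuous_mollifier.
  apply: eq_Rintegral => u _; rewrite /phase !cosBpi2.
  have -> : 2 * pi * (s + 1 * u) * (-1 * x + 0) = - (2 * pi * (s + 1 * u) * x) by ring.
  by rewrite sinN; ring.
rewrite RintegralZl//; lra.
Qed.

Lemma profile_continuous : continuous profile.
Proof.
move=> s.
have [K K0 hK] := osc_decay mollifierP.
have Is : s \in (`]s - 1, s + 1[%classic : set R).
  by rewrite inE /= in_itv /=; apply/andP; split; lra.
have hi : mu.-integrable setT (EFin \o (fun x => K * (1 + (1 * x) ^+ 2)^-1)).
  under [X in _.-integrable _ X]eq_fun do rewrite /= EFinM.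
  by apply: integrableZl => //; exact/integrable_oneDsqrVM/oner_neq0.
apply: (@continuity_under_integral _ _ _ mu (fun s x => osc mollifier 0 s 1 x) setT
  measurableT (s - 1) (s + 1) _ _ _ hi) => //.
- by move=> t _; apply: integrable_osc => //; exact: mollifierP.
- apply: aeW => x _ t _.
  (* Moving the frequency to [0] leaves a dependence on [t] through the modulation factors only,
     which are continuous. *)
  have -> : (fun t => osc mollifier 0 t 1 x) = (fun t =>
     cos (2 * pi * t * x) * osc mollifier 0 0 1 x +
     sin (2 * pi * t * x) * osc mollifier (0 + pi / 2) 0 1 x).
    by apply/funext => r; rewrite -(@osc_shift _ mollifier 0 0 r 1 x continuous_mollifier) add0r.
  have cl : continuous (fun t => 2 * pi * t * x).
    move=> r; apply: cvgM; last exact: cvg_cst.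
    by apply: cvgM; [exact: cvg_cst|exact: cvg_id].
  apply: cvgD; (apply: cvgM; last exact: cvg_cst).
  + apply: (@continuous_comp _ _ _ (fun t => 2 * pi * t * x) cos); first exact: cl.
    exact: continuous_cos.
  + apply: (@continuous_comp _ _ _ (fun t => 2 * pi * t * x) sin); first exact: cl.
    exact: continuous_sin.
- by move=> t _; apply: aeW => x _; exact: hK.
Qed.

Lemma integrable_mollifier : mu.-integrable setT (EFin \o @mollifier R).
Proof.
have -> : EFin \o @mollifier R = (EFin \o @mollifier R) \_ `[(-1), 1].
  apply/funext => x; rewrite patchE; case: ifPn => //.
  rewrite notin_setE /= in_itv /= => /negP h; rewrite (bump_supp mollifierP)//.
  by move: h; rewrite -ler_norml -ltNge => /ltW.
have mi : measurable (`[(-1), 1]%classic : set (measurableTypeR R)) by [].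
apply/(integrable_mkcond _ mi).1.
exact/continuous_integrable11/continuous_mollifier.
Qed.

Lemma osc_mollifierT th a l x :
  osc mollifier th a l x = \int[mu]_u (mollifier u * cos (phase th a l x u)).
Proof.
rewrite /osc Rintegral_mkcond; apply: eq_Rintegral => u _.
rewrite patchE; case: ifPn => //.
rewrite notin_setE /= in_itv /= => /negP h; rewrite (bump_supp mollifierP) ?mul0r//.
by move: h; rewrite -ler_norml -ltNge => /ltW.
Qed.

Let fejer_mollifier N s (z : R * R) : R :=
  mollifier z.1 * (fejer N z.2 * cos (2 * pi * (s + z.1) * z.2)).

Let integrable_fejer_mollifier N s : 0 < N ->
  mu2.-integrable setT (EFin \o fejer_mollifier N s).
Proof.
move=> N0.
have := integrable_prod_mul integrable_mollifier (integrable_fejer N0).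
apply: le_integrable => //.
  apply/measurable_EFinP; apply: measurable_funM.
    apply: (measurableT_comp _ measurable_fst).
    by apply: continuous_measurable_fun; exact: continuous_mollifier.
  apply: measurable_funM.
    apply: (measurableT_comp _ measurable_snd).
    by apply: continuous_measurable_fun; exact: continuous_fejer.
  apply: (@measurableT_comp _ _ _ _ _ _ cos).
    by apply: continuous_measurable_fun; exact: continuous_cos.
  apply: measurable_funM; last exact: measurable_snd.
  apply: measurable_funM => //; apply: measurable_funD => //; exact: measurable_fst.
move=> z _; rewrite /fejer_mollifier /= lee_fin mulrA normrM ler_piMr//.
by rewrite ler_norml cos_geN1 cos_le1.
Qed.

Let integrable_fejer_mollifier1 N s u : 0 < N ->
  mu.-integrable setT (EFin \o (fun x => fejer_mollifier N s (u, x))).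
Proof.
move=> N0.
exact: (@integrableZl _ _ _ mu setT measurableT (mollifier u)
  (EFin \o (fun x => fejer N x * cos (2 * pi * (s + u) * x))) (integrable_fejer_cos _ N0)).
Qed.

Lemma integrable_fejer_kernel N s : 0 < N ->
  mu.-integrable setT (EFin \o (fun u => mollifier u * fejer_kernel N (s + u))).
Proof.
move=> N0; have := integrable_Rintegral_prod (integrable_fejer_mollifier s N0)
  (fun u => integrable_fejer_mollifier1 s u N0).
apply: eq_integrable => // u _ /=; congr (_%:E).
by rewrite /fejer_kernel -RintegralZl//; exact: integrable_fejer_cos.
Qed.

(** Fubini: the cutoff makes the double integral absolutely convergent, and integrating in [x] first
    produces the Fejer kernel. *)
Lemma fejer_mean N s : 0 < N ->
  \int[mu]_x (fejer N x * osc mollifier 0 s 1 x) =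
  \int[mu]_u (mollifier u * fejer_kernel N (s + u)).
Proof.
move=> N0; transitivity (\int[mu]_u \int[mu]_x fejer_mollifier N s (u, x)); last first.
  apply: eq_Rintegral => u _.
  by rewrite /fejer_kernel -RintegralZl//; exact: integrable_fejer_cos.
rewrite (Rintegral_swap (integrable_fejer_mollifier s N0)).
apply: eq_Rintegral => x _; rewrite osc_mollifierT -RintegralZl//; last first.
  have := integrable_mollifier; apply: le_integrable => //.
    apply/measurable_EFinP; apply: continuous_measurable_fun.
    exact/continuous_mul_cos/continuous_mollifier.
  move=> u _; rewrite /= lee_fin normrM ler_piMr//.
  by rewrite ler_norml cos_geN1 cos_le1.
apply: eq_Rintegral => u _; rewrite /fejer_mollifier /phase /= mul1r addr0; ring.
Qed.

(** Dominated convergence: the tents are at most [1] and tend to [1] pointwise, and [osc] is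
    integrable in [x]. The index [n.+1] keeps the width positive. *)
Lemma fejer_mean_cvg s :
  (\int[mu]_u (mollifier u * fejer_kernel n.+1%:R (s + u))) @[n --> \oo] --> profile s.
Proof.
have io := @integrable_osc _ 0 s 1 mollifierP (oner_neq0 _).
suff : (\int[mu]_x (fejer n.+1%:R x * osc mollifier 0 s 1 x)) @[n --> \oo] --> profile s.
  by under eq_fun do rewrite fejer_mean//.
apply: fine_cvg; rewrite /profile /Rintegral fineK; last exact: integrable_fin_num io.
apply: (@dominated_cvg _ _ _ mu setT measurableT
  (fun n x => (fejer n.+1%:R x * osc mollifier 0 s 1 x)%:E)
  (EFin \o osc mollifier 0 s 1) (fun x => `|(osc mollifier 0 s 1 x)%:E|%E)) => //.
- move=> n; apply/measurable_EFinP; apply: continuous_measurable_fun => x.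
  apply: cvgM; first exact: continuous_fejer.
  exact/continuous_osc/continuous_mollifier.
- move=> x _; apply: cvg_EFin; first exact: nearW.
  rewrite /comp /= -[X in _ --> X]mul1r; apply: cvgM; last exact: cvg_cst.
  apply: (@squeeze_cvgr _ _ _ _ (fun n => 1 - `|x| * n.+1%:R^-1) (cst 1)).
  + apply: nearW => n; rewrite fejer_le1// andbT.
    by rewrite le_max lexx orbT.
  + rewrite -[X in _ --> X](subr0 1); apply: cvgB; first exact: cvg_cst.
    rewrite -(mulr0 `|x|); apply: cvgM; [exact: cvg_cst|exact: cvg_harmonic].
  + exact: cvg_cst.
- exact: integrable_abse.
- move=> n x _; rewrite /= lee_fin normrM ler_piMl//.
  by rewrite ger0_norm ?fejer_ge0// fejer_le1.
Qed.

Lemma profile_ge0 s : 0 <= profile s.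
Proof.
apply: (ler_cvgn (u := fun=> 0) _ (@fejer_mean_cvg s)) => [|n]; first exact: cvg_cst.
 apply: Rintegral_ge0 => u _.
by rewrite mulr_ge0 ?mollifier_ge0 ?fejer_kernel_ge0.
Qed.

(** On the support of the mollifier [s + u] is at distance at least [|s| - 1] from [0], where the
    Fejer kernel is [O(1/N)]. *)
Lemma profile_out s : 1 < `|s| -> profile s = 0.
Proof.
move=> s1; apply/eqP; rewrite eq_le profile_ge0 andbT.
pose d := `|s| - 1; have d0 : 0 < d by rewrite subr_gt0.
pose B := \int[mu]_u mollifier u.
have Bd : (B * (d ^+ 2)^-1 * n.+1%:R^-1) @[n --> \oo] --> (0 : R).
  by rewrite -(mulr0 (B * (d ^+ 2)^-1)); apply: cvgM; [exact: cvg_cst|exact: cvg_harmonic].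
apply: (ler_cvgn (@fejer_mean_cvg s) Bd) => n.
rewrite -mulrA -RintegralZr//; last exact: integrable_mollifier.
apply: le_Rintegral => //.
- exact: integrable_fejer_kernel.
- under [X in _.-integrable _ X]eq_fun do rewrite /= mulrC EFinM.
  by apply: integrableZl => //; exact: integrable_mollifier.
move=> u _; have [u1|u1] := leP 1 `|u|; first by rewrite (bump_supp mollifierP)// !mul0r.
have su : d <= `|s + u|.
  by rewrite -[u]opprK (le_trans _ (lerB_dist _ _))// normrN lerB// ltW.
have su0 : s + u != 0 by rewrite -normr_gt0 (lt_le_trans d0).
rewrite ler_wpM2l ?mollifier_ge0// (le_trans (fejer_kernel_le _ su0))//.
rewrite invfM mulrC ler_wpM2r ?invr_ge0// lef_pV2 ?posrE; last 2 first.
- by rewrite exprn_even_gt0.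
- exact: exprn_gt0.
by rewrite -[leRHS]real_normK ?num_real// ler_pXn2r ?nnegrE// ltW.
Qed.

(** On [[0, r / N]] the kernel is at least [N / 8] and the mollifier at least [c], so every Fejer
    mean is at least [c * r / 8], whatever [N]. *)
Lemma profile0_gt0 : 0 < profile 0.
Proof.
have [d d0 hd] := @fejer_kernel_near0 R.
pose r := Num.min d 2^-1.
have r0 : 0 < r by rewrite lt_min d0 invr_gt0 ltr0n.
(* For [0 <= u <= 1/2] one has [1 / (1 + u) <= 1] and [1 / (1 - u) <= 2]. *)
pose c : R := expR (-1) * expR (- 2).
have c0 : 0 < c by rewrite mulr_gt0 ?expR_gt0.
have bc u : 0 <= u -> u <= 2^-1 -> c <= mollifier u.
  move=> u0 u2; have p1 : 0 < 1 + u by lra.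
  have p2 : 0 < 1 - u by lra.
  rewrite /mollifier /flat p1 p2 !expr0 !mul1r ler_pM ?expR_ge0// ler_expR lerN2.
    by rewrite invf_le1//; lra.
  by rewrite -[leRHS]invrK lef_pV2 ?posrE ?invr_gt0//; lra.
suff : c * r / 8 <= profile 0 by apply: lt_le_trans; rewrite !mulr_gt0// invr_gt0.
apply: (ler_cvgn (u := fun=> c * r / 8) _ (@fejer_mean_cvg 0)) => [|n]; first exact: cvg_cst.
 set N : R := n.+1%:R.
have N0 : 0 < N by rewrite ltr0n.
have N1 : 1 <= N by rewrite ler1n.
have -> : c * r / 8 = \int[mu]_x ((c * (N / 8)) * \1_(`[0, r / N]%classic : set R) x).
  rewrite RintegralZl//; last exact: integrable_indic_itv.
  rewrite /Rintegral integral_indic// setIT /= lebesgue_measure_itv/= lte_fin divr_gt0//.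
  by rewrite oppr0 /= addr0; field; rewrite gt_eqF.
apply: le_Rintegral => //.
- under [X in _.-integrable _ X]eq_fun do rewrite /= EFinM.
  by apply: integrableZl => //; exact: integrable_indic_itv.
- exact: integrable_fejer_kernel.
move=> u _; rewrite indicE; have [|_] := boolP (u \in _); last first.
  by rewrite mulr0 mulr_ge0 ?mollifier_ge0// fejer_kernel_ge0.
rewrite inE /= in_itv /= => /andP[u0 u1]; rewrite mulr1.
rewrite add0r; apply: ler_pM; rewrite ?divr_ge0 ?(ltW c0) ?(ltW N0)//.
  apply: bc => //; apply: (le_trans u1); rewrite ler_pdivrMr//.
  by rewrite (@le_trans _ _ 2^-1) ?ge_min ?lexx ?orbT// ler_peMr.
apply: hd => //; rewrite ger0_norm// (le_trans u1)// ler_pM2r ?invr_gt0//.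
by rewrite ge_min lexx.
Qed.

End Profile.

                     

(** * Wave packets: Fourier transform and norms *)

Section Packets.
Variable R : realType.
Local Notation mu := (@lebesgue_measure R).
Implicit Types (a l s x xi : R).

(** This is the integral over [u] of [mollifier u] times [e^(2 pi i (a + l u) x)]: a wave of
    frequency [a] under an envelope of width about [1 / l]. *)
Definition packet l a x : R[i] :=
  Complex (osc mollifier 0 a l x) (osc mollifier (- (pi / 2)) a l x).

Lemma packet_modulation l a x xi :
  packet l a x * cexpi (- (2 * pi * x * xi)) = packet l (a - xi) x.
Proof.
have cm := @continuous_mollifier R.
rewrite /packet !osc_shift// addNr add0r.
have -> : osc mollifier (pi / 2) a l x = - osc mollifier (- (pi / 2)) a l x.
  by rewrite -osc_phaseN//; congr osc; field.
have -> : 2 * pi * - xi * x = - (2 * pi * x * xi) by ring.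
by congr Complex; ring.
Qed.

Lemma osc_mollifierE l th s x : l != 0 ->
  osc mollifier th s l x = osc mollifier th (s / l) 1 (l * x + 0).
Proof. by move=> l0; rewrite addr0 [RHS]osc_scale mul1r divfK. Qed.

Definition window l a xi : R := l^-1 * profile ((a - xi) / l).

(** The Fourier character moves the frequency from [a] to [a - xi]; substituting [l x] then gives
    [profile] in the real part and, by oddness, zero in the imaginary part. *)
Lemma fourier_packet l a xi : 0 < l ->
  fourier (packet l a) xi = Complex (window l a xi) 0.
Proof.
move=> l0; have ln0 : l != 0 by rewrite gt_eqF.
have i1 th := @integrable_osc _ mollifier th ((a - xi) / l) 1 (@mollifierP R) (oner_neq0 _).
rewrite /fourier /cint; congr Complex.
  transitivity (\int[mu]_x osc mollifier 0 ((a - xi) / l) 1 (l * x + 0)).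
    by apply: eq_Rintegral => x _; rewrite packet_modulation /= osc_mollifierE.
  by rewrite (Rintegral_affine 0 ln0 (i1 0)) gtr0_norm.
transitivity (\int[mu]_x osc mollifier (- (pi / 2)) ((a - xi) / l) 1 (l * x + 0)).
  by apply: eq_Rintegral => x _; rewrite packet_modulation /= osc_mollifierE.
by rewrite (Rintegral_affine 0 ln0 (i1 _)) integral_osc_odd mulr0.
Qed.

Lemma continuous_window l a : continuous (window l a).
Proof.
move=> x; apply: cvgM; first exact: cvg_cst.
apply: (@continuous_comp _ _ _ (fun x => (a - x) / l) (@profile R)).
  apply: cvgM; last exact: cvg_cst.
  by apply: cvgB; [exact: cvg_cst|exact: cvg_id].
exact: profile_continuous.
Qed.

Lemma window_ge0 l a xi : 0 < l -> 0 <= window l a xi.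
Proof. by move=> l0; rewrite mulr_ge0 ?profile_ge0// invr_ge0 ltW. Qed.

Lemma window_out l a xi : 0 < l -> l < `|a - xi| -> window l a xi = 0.
Proof.
move=> l0 h; rewrite /window profile_out ?mulr0//.
by rewrite normrM normfV (gtr0_norm l0) ltr_pdivlMr// mul1r.
Qed.

Lemma packet_classP l a : 0 < l -> classP (packet l a).
Proof.
move=> l0; have ln0 : l != 0 by rewrite gt_eqF.
split; first by split; exact: osc_schwartz (@mollifierP R).
split; [|split].
- rewrite (_ : (fun xi => _) = window l a); first exact: continuous_window.
  by apply/funext => xi; rewrite fourier_packet.
- rewrite (_ : (fun xi => _) = (fun=> 0)); first by move=> x; exact: cvg_cst.
  by apply/funext => xi; rewrite fourier_packet.
- exists (`|a| + l) => xi h; rewrite fourier_packet// window_out//.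
  have := lerB_dist xi a; rewrite distrC; lra.
Qed.

Lemma cabs_le (z : R[i]) : cabs z <= `|complex.Re z| + `|complex.Im z|.
Proof.
rewrite /cabs -[leRHS]ger0_norm ?addr_ge0// -sqrtr_sqr ler_wsqrtr//.
rewrite sqrrD !real_normK ?num_real//.
by rewrite lerD2r lerDl mulrn_wge0// mulr_ge0.
Qed.

Lemma Re_le_cabs (z : R[i]) : `|complex.Re z| <= cabs z.
Proof. by rewrite /cabs -sqrtr_sqr ler_wsqrtr// lerDl sqr_ge0. Qed.

Lemma Im_le_cabs (z : R[i]) : `|complex.Im z| <= cabs z.
Proof. by rewrite /cabs -sqrtr_sqr ler_wsqrtr// lerDr sqr_ge0. Qed.

Lemma packet_decay : exists2 K : R, 0 < K &
  forall l a x, cabs (packet l a x) <= K * (1 + (l * x) ^+ 2)^-1.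
Proof.
have [K K0 hK] := osc_decay (@mollifierP R).
exists (2 * K); first exact: mulr_gt0.
move=> l a x; apply: (le_trans (cabs_le _)) => /=.
by rewrite -mulrA mulr_natl mulr2n lerD// hK.
Qed.

Lemma measurable_cabs_packet l a : measurable_fun setT (fun x => cabs (packet l a x)).
Proof.
have c th : continuous (osc mollifier th a l) by exact/continuous_osc/continuous_mollifier.
apply: continuous_measurable_fun => x.
apply: (@continuous_comp _ _ _ (fun x => osc mollifier 0 a l x ^+ 2 +
   osc mollifier (- (pi / 2)) a l x ^+ 2) Num.sqrt); last exact: sqrt_continuous.
by apply: cvgD; apply: cvgM; exact: c.
Qed.

(** The decay bound depends on [l x] alone, so the substitution costs a factor [l^(-1)] in the
    integral of the [p]-th power. *)
Lemma Lpnorm_packet (p : \bar R) : (1 <= p)%E -> exists2 c : R, 0 < c &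
  forall l a, 0 < l -> (Lpnorm p (packet l a) <= (c * l `^ (- inv_exp p))%:E)%E.
Proof.
have [K K0 hK] := packet_decay.
have cge0 (z : R[i]) : 0 <= cabs z by exact: sqrtr_ge0.
case: p => [r|_|//]; last first.
  (* The case [p = +oo]: the power of [l] has exponent [0] and the uniform bound [K] suffices. *)
  exists K => // l a l0; rewrite /= oppr0 powRr0 mulr1 /Lpnorm unlock.
  case: ifP => // _; last by rewrite lee_fin ltW.
  apply/ess_supP; apply: aeW => x /=; rewrite lee_fin ger0_norm//.
  apply: (le_trans (hK l a x)); rewrite ler_piMr ?(ltW K0)// invf_le1.
    by rewrite lerDl sqr_ge0.
  by rewrite ltr_pwDl// sqr_ge0.
rewrite lee_fin => r1; have r0 : 0 < r by lra.
pose J := \int[mu]_x (1 + x ^+ 2)^-1 + 1.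
have Jge0 : 0 <= \int[mu]_x (1 + x ^+ 2)^-1.
  by apply: Rintegral_ge0 => x _; rewrite invr_ge0 addr_ge0// sqr_ge0.
have J0 : 0 < J by rewrite /J ltr_wpDl.
exists ((K `^ r * J) `^ r^-1); first by rewrite powR_gt0// mulr_gt0// powR_gt0.
move=> l a l0; have ln0 : l != 0 by rewrite gt_eqF.
rewrite /inv_exp /Lpnorm unlock.
have -> : (K `^ r * J) `^ r^-1 * l `^ (- r^-1) = (K `^ r * (l^-1 * J)) `^ r^-1.
  have li : 0 <= l^-1 by rewrite invr_ge0 ltW.
  rewrite mulrCA [RHS]powRM//; last by rewrite mulr_ge0 ?powR_ge0// ltW.
  by rewrite mulrC powRN -[l^-1]powR_inv1 ?ltW// -powRrM mulN1r powRN.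
rewrite -poweR_EFin; apply: gt0_ler_poweR.
- by rewrite invr_ge0 ltW.
- rewrite in_itv /= leey andbT; apply: integral_ge0 => x _.
  by rewrite lee_fin powR_ge0.
- rewrite in_itv /= leey andbT lee_fin mulr_ge0 ?powR_ge0//.
  by rewrite mulr_ge0 ?invr_ge0 ?(ltW l0) ?(ltW J0).
have pos x : 0 < 1 + (l * x) ^+ 2 by rewrite ltr_pwDl// sqr_ge0.
have step : (\int[mu]_x (`|(cabs (packet l a x))%:E| `^ r) <=
    \int[mu]_x ((K `^ r)%:E * ((1 + (l * x) ^+ 2)^-1)%:E))%E.
  apply: ge0_le_integral => //.
  - by move=> x _; exact: poweR_ge0.
  - under eq_fun do rewrite abse_EFin poweR_EFin.
    apply/measurable_EFinP; apply: (measurableT_comp (measurable_powR _)).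
    by apply: measurableT_comp => //; exact: measurable_cabs_packet.
  - apply/measurable_EFinP; apply: measurable_funM => //.
    have := integrable_oneDsqrVM ln0 => /integrableP[/measurable_EFinP]//.
  - move=> x _; rewrite abse_EFin poweR_EFin ger0_norm// -EFinM lee_fin.
    (* As this quantity is at most [1] and [r >= 1], its [r]-th power is at most itself, so one
       integral serves for all exponents. *)
    have Vle1 : 0 < (1 + (l * x) ^+ 2)^-1 <= 1.
      by rewrite invr_gt0 pos /= invf_le1// lerDl sqr_ge0.
    apply: (@le_trans _ _ ((K * (1 + (l * x) ^+ 2)^-1) `^ r)).
      by apply: ge0_ler_powR; rewrite ?nnegrE ?(ltW r0)// mulr_ge0 ?invr_ge0 ?ltW.
    rewrite powRM ?(ltW K0)//; last by rewrite invr_ge0 ltW.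
    by rewrite ler_wpM2l ?powR_ge0// ge1r_powR.
apply: (le_trans step).
have m1 : measurable_fun setT (fun x : R => ((1 + x ^+ 2)^-1)%:E).
  by have /integrableP[] := @integrable_oneDsqrV R.
have V0 (x : R) : (0 <= ((1 + x ^+ 2)^-1)%:E)%E.
  by rewrite lee_fin invr_ge0 addr_ge0// sqr_ge0.
rewrite ge0_integralZl_EFin ?powR_ge0//; last first.
  by have /integrableP[] := integrable_oneDsqrVM ln0.
rewrite [X in (_ * X <= _)%E](_ : _ = (`|l|^-1)%:E * \int[mu]_x ((1 + x ^+ 2)^-1)%:E)%E; last first.
  rewrite -(@ge0_integral_affine R l 0 (fun x => ((1 + x ^+ 2)^-1)%:E) ln0 m1 V0).
  by apply: eq_integral => x _; rewrite addr0.
rewrite (gtr0_norm l0) !EFinM lee_pmul2l ?lte_fin ?powR_gt0//.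
rewrite lee_pmul2l ?lte_fin ?invr_gt0//.
rewrite -(fineK (integrable_fin_num measurableT (@integrable_oneDsqrV R))).
by rewrite lee_fin /J lerDl.
Qed.

End Packets.

(** * Mass of the windows and the convolution estimate *)

Section Windows.
Variable R : realType.
Local Notation mu := (@lebesgue_measure R).
Local Notation mu2 := (product_measure1 mu mu).
Implicit Types (a l s x xi : R).

Lemma integrable_profile : mu.-integrable setT (EFin \o @profile R).
Proof.
have -> : EFin \o @profile R = (EFin \o @profile R) \_ `[(-1), 1].
  apply/funext => x; rewrite patchE; case: ifPn => //.
  rewrite notin_setE /= in_itv /= => /negP h; rewrite profile_out//.
  by move: h; rewrite -ler_norml -ltNge.
have mi : measurable (`[(-1), 1]%classic : set (measurableTypeR R)) by [].
apply/(integrable_mkcond _ mi).1.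
exact/continuous_integrable11/profile_continuous.
Qed.

Definition profile_mass : R := \int[mu]_x profile x.

Lemma Rintegral_gt0 (f : R -> R) : continuous f -> (forall x, 0 <= f x) ->
  mu.-integrable setT (EFin \o f) -> 0 < f 0 -> 0 < \int[mu]_x f x.
Proof.
move=> cf f0 fi p0; set p := f 0 in p0.
have p2 : 0 < p / 2 by rewrite divr_gt0.
have /cvgrPdist_le/(_ _ p2) [d /= d0 hd] := cf 0.
have d2 : 0 < d / 2 by rewrite divr_gt0.
apply: (@lt_le_trans _ _ (p / 2 * (d / 2))); first exact: mulr_gt0.
have -> : p / 2 * (d / 2) =
   \int[mu]_x ((p / 2) * \1_(`[0, d / 2]%classic : set R) x).
  rewrite RintegralZl//; last exact: integrable_indic_itv.
  rewrite /Rintegral integral_indic// setIT /= lebesgue_measure_itv/= lte_fin d2.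
  by rewrite oppr0 /= addr0.
apply: le_Rintegral => //.
  under [X in _.-integrable _ X]eq_fun do rewrite /= EFinM.
  by apply: integrableZl => //; exact: integrable_indic_itv.
move=> u _; rewrite indicE; have [|_] := boolP (u \in _); last by rewrite mulr0.
rewrite inE /= in_itv /= => /andP[u0 u1]; rewrite mulr1.
have ud : `|0 - u| < d by rewrite sub0r normrN ger0_norm//; lra.
by have := hd u ud; rewrite -/p ler_norml => /andP[_]; lra.
Qed.

Lemma profile_mass_gt0 : 0 < profile_mass.
Proof.
apply: Rintegral_gt0; [exact: profile_continuous|exact: profile_ge0|
  exact: integrable_profile|exact: profile0_gt0].
Qed.

Lemma profile_bounded : exists2 c : R, 0 < c & forall s, profile s <= c.
Proof.
have [K K0 hK] := osc_decay (@mollifierP R).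
pose J := \int[mu]_x (1 + (1 * x) ^+ 2)^-1.
have J0 : 0 <= J.
  by apply: Rintegral_ge0 => x _; rewrite invr_ge0 addr_ge0// sqr_ge0.
have iV := integrable_oneDsqrVM (oner_neq0 R).
exists (K * J + 1); first by rewrite ltr_wpDl// mulr_ge0// ltW.
move=> s; rewrite (@le_trans _ _ (K * J))// ?lerDl//.
rewrite /J -RintegralZl//; apply: le_Rintegral => //.
- by apply: integrable_osc; [exact: mollifierP|exact: oner_neq0].
- under [X in _.-integrable _ X]eq_fun do rewrite /= EFinM.
  exact: integrableZl.
- by move=> x _; apply: (le_trans (ler_norm _)); exact: hK.
Qed.

Lemma window_affineE l a xi :
  window l a xi = l^-1 * @profile R (- l^-1 * xi + a / l).
Proof. by rewrite /window; congr (_ * profile _); rewrite mulrBl mulNr addrC [xi / l]mulrC. Qed.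

Lemma integrable_window l a : 0 < l -> mu.-integrable setT (EFin \o window l a).
Proof.
move=> l0; under [X in _.-integrable _ X]eq_fun do rewrite /= window_affineE EFinM.
apply: integrableZl => //; apply: (@integrable_affine _ _ _ (@profile R)).
  by rewrite oppr_eq0 invr_eq0 gt_eqF.
exact: integrable_profile.
Qed.

Lemma Rintegral_window l a : 0 < l -> \int[mu]_x window l a x = profile_mass.
Proof.
move=> l0; have li : - l^-1 != 0 by rewrite oppr_eq0 invr_eq0 gt_eqF.
under eq_Rintegral do rewrite window_affineE.
rewrite RintegralZl//; last exact: (integrable_affine _ li integrable_profile).
rewrite (@Rintegral_affine _ _ _ (@profile R) li integrable_profile).
by rewrite normrN normfV invrK (gtr0_norm l0) mulrA mulVf ?mul1r// gt_eqF.
Qed.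

Lemma integral_window l a : 0 < l -> (\int[mu]_x (window l a x)%:E = profile_mass%:E)%E.
Proof.
move=> l0; rewrite -(Rintegral_window a l0) /Rintegral fineK//.
exact: integrable_fin_num (integrable_window a l0).
Qed.

Lemma measurable_sub2 (h : R -> R) : measurable_fun setT h ->
  measurable_fun setT (fun z : measurableTypeR R * measurableTypeR R => h (z.1 - z.2)).
Proof.
move=> mh; apply: (measurableT_comp mh).
by apply: measurable_funB; [exact: measurable_fst|exact: measurable_snd].
Qed.

Lemma measurable_window l a : measurable_fun setT (window l a : R -> R).
Proof. by apply: continuous_measurable_fun; exact: continuous_window. Qed.

Lemma integral_window_conv l m (h : R -> R) : 0 < l ->
  measurable_fun setT h -> (forall x, 0 <= h x) ->
  (\int[mu]_x \int[mu]_y (window l m x * h (x - y))%:E =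
   profile_mass%:E * \int[mu]_y (h y)%:E)%E.
Proof.
move=> l0 mh h0.
have mhE : measurable_fun setT (fun x => (h x)%:E) by exact/measurable_EFinP.
have h0E x : (0 <= (h x)%:E)%E by rewrite lee_fin.
have m1 : -1 != 0 :> R by rewrite oppr_eq0 oner_eq0.
have e x : (\int[mu]_y (window l m x * h (x - y))%:E =
   (window l m x)%:E * \int[mu]_y (h y)%:E)%E.
  under eq_integral do rewrite EFinM.
  rewrite ge0_integralZl_EFin ?window_ge0//; last first.
    apply/measurable_EFinP; apply: (measurableT_comp mh).
    exact: measurable_funB.
  congr (_ * _)%E.
  have := @ge0_integral_affine R (-1) x (fun y => (h y)%:E) m1 mhE h0E.
  rewrite normrN1 invr1 mul1e => <-.
  by apply: eq_integral => y _; rewrite mulN1r addrC.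
under eq_integral do rewrite e.
rewrite ge0_integralZr//.
- by rewrite integral_window.
- by apply/measurable_EFinP; exact: measurable_window.
- by move=> x _; rewrite lee_fin window_ge0.
- exact: integral_ge0.
Qed.

(** Where both windows are nonzero, [x - y] is within [2 l] of [m], hence in the open ball of radius
    [3 l]. Bounding the second window by [c / l] leaves the first window against a reflected
    translate of [h] cut off to that ball, and this integral factors. *)
Lemma window_window_le c l m (h : R -> R) : 0 < l -> (forall s, @profile R s <= c) ->
  measurable_fun setT h -> (forall x, 0 <= h x) ->
  (\int[mu]_x \int[mu]_y (window l m x * window l 0 y * h (x - y))%:E <=
   (c / l * profile_mass)%:E * \int[mu]_(y in ball m (3 * l)) (h y)%:E)%E.
Proof.
move=> l0 hc mh h0.
pose B : set (measurableTypeR R) := ball m (3 * l).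
have mB : measurable B by exact: measurable_ball.
have c0 : 0 <= c by exact: le_trans (profile_ge0 0) (hc 0).
pose H x := c / l * (h \_ B) x.
have mH : measurable_fun setT H.
  apply: measurable_funM => //; apply/(measurable_restrictT _ _).1 => //.
  exact: measurable_funS mh.
have hB0 x : 0 <= (h \_ B) x by rewrite patchE; case: ifPn.
have H0 x : 0 <= H x by rewrite mulr_ge0// divr_ge0// ltW.
have -> : ((c / l * profile_mass)%:E * \int[mu]_(y in ball m (3 * l)) (h y)%:E =
   profile_mass%:E * \int[mu]_y (H y)%:E)%E.
  rewrite mulrC EFinM -muleA; congr (_ * _)%E; rewrite /H.
  under [RHS]eq_integral do rewrite EFinM.
  rewrite ge0_integralZl_EFin//.
  - congr (_ * _)%E; rewrite [LHS]integral_mkcond; apply: eq_integral => x _.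
    by rewrite !patchE; case: ifP.
  - by move=> x _; rewrite lee_fin.
  - apply/measurable_EFinP; apply/(measurable_restrictT _ _).1 => //.
    exact: measurable_funS mh.
  - by rewrite divr_ge0// ltW.
rewrite -(@integral_window_conv l m)//.
pose f1 (z : measurableTypeR R * measurableTypeR R) : \bar R :=
  (window l m z.1 * window l 0 z.2 * h (z.1 - z.2))%:E.
pose f2 (z : measurableTypeR R * measurableTypeR R) : \bar R :=
  (window l m z.1 * H (z.1 - z.2))%:E.
have mw1 : measurable_fun setT (fun z : measurableTypeR R * measurableTypeR R => window l m z.1).
  by apply: (measurableT_comp _ measurable_fst); exact: measurable_window.
have mf1 : measurable_fun setT f1.
  apply/measurable_EFinP; apply: measurable_funM; last exact: measurable_sub2.
  exact: (measurable_prod_mul (measurable_window l m) (measurable_window l 0)).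
have mf2 : measurable_fun setT f2.
  by apply/measurable_EFinP; exact: (measurable_funM mw1 (measurable_sub2 mH)).
have f10 z : (0 <= f1 z)%E by rewrite lee_fin; apply: mulr_ge0; [apply: mulr_ge0; exact: window_ge0|exact: h0].
have f20 z : (0 <= f2 z)%E by rewrite lee_fin; apply: mulr_ge0; [exact: window_ge0|exact: H0].
(* Both iterated integrals become integrals on the product, where the integrands can be compared
   pointwise. *)
have e1 := @fubini_tonelli1 _ _ _ _ _ mu mu f1 mf1 f10.
have e2 := @fubini_tonelli1 _ _ _ _ _ mu mu f2 mf2 f20.
rewrite /fubini_F /f1 /= in e1; rewrite /fubini_F /f2 /= in e2.
rewrite -e1 -e2; apply: ge0_le_integral => //; first by move=> z _; exact: f10.
move=> [x y] _; rewrite lee_fin /H /=.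
have [lx|lx] := ltP l `|m - x|; first by rewrite (window_out l0 lx) !mul0r.
have [ly|ly] := ltP l `|0 - y|.
  by rewrite [window l 0 y]window_out// mulr0 mul0r mulr_ge0 ?window_ge0//; exact: H0.
have xB : B (x - y).
  rewrite /B /ball /= opprB addrCA addrC.
  apply: (le_lt_trans (ler_normD _ _)).
  rewrite sub0r normrN in ly; lra.
rewrite patchE mem_set// -mulrA ler_wpM2l ?window_ge0// ler_wpM2r//.
by rewrite /window mulrC ler_wpM2r ?invr_ge0 ?(ltW l0).
Qed.

End Windows.

                                       

(** * Lower bound for the bilinear operator near a Lebesgue point *)

Section BilinearLowerBound.
Variable R : realType.
Local Notation mu := (@lebesgue_measure R).
Local Notation mu2 := (product_measure1 mu mu).
Local Notation R2 := (measurableTypeR R * measurableTypeR R)%type.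
Implicit Types (l m x : R) (h : R -> R).

Lemma lebesgue_pt_le h m (e : R) : lebesgue_pt h m -> 0 < e ->
  exists2 r0 : R, 0 < r0 & forall r, 0 < r -> r < r0 ->
    (\int[mu]_(y in ball m r) (`|h y - h m|)%:E <= (e * (r *+ 2))%:E)%E.
Proof.
move=> hm e0.
have e0' : (0 < e%:E)%E by rewrite lte_fin.
have hn : nbhs (0%E : \bar R) [set y | (y < e%:E)%E] by apply: open_nbhs_nbhs; split => //; exact: open_ereal_lt_ereal.
have := hm _ hn; rewrite /nbhs /= => -[d /= d0 hd].
exists d => // r r0 rd.
have : (davg h m r < e%:E)%E.
  by apply: hd => //=; rewrite sub0r normrN gtr0_norm.
rewrite /davg /iavg lebesgue_measure_ball ?(ltW r0)//.
have r2 : 0 < r *+ 2 by rewrite pmulrn_lgt0.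
rewrite inver gt_eqF// lte_pdivrMl// => /ltW; rewrite -EFinM mulrC.
apply: le_trans; rewrite le_eqVlt; apply/orP; left; apply/eqP.
by apply: eq_integral => y _.
Qed.

Definition windows l m (z : R2) : R := window l m z.1 * window l 0 z.2.

Lemma measurable_windows l m : measurable_fun setT (windows l m).
Proof. exact: (measurable_prod_mul (measurable_window l m) (measurable_window l 0)). Qed.

Lemma windows_ge0 l m z : 0 < l -> 0 <= windows l m z.
Proof. by move=> l0; apply: mulr_ge0; exact: window_ge0. Qed.

Lemma integrable_windows l m : 0 < l -> mu2.-integrable setT (EFin \o windows l m).
Proof. by move=> l0; apply: integrable_prod_mul; exact: integrable_window. Qed.

Lemma Rintegral_windows l m : 0 < l ->
  \int[mu2]_z windows l m z = profile_mass R ^+ 2.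
Proof.
move=> l0; rewrite expr2 -{1}(Rintegral_window m l0) -(Rintegral_window 0 l0).
exact: (Rintegral_prod_mul (integrable_window m l0) (integrable_window 0 l0)).
Qed.

Lemma integrable_windows_sub l m h : 0 < l -> measurable_fun setT h ->
  (\int[mu]_(y in ball m (3 * l)) (`|h y|)%:E < +oo)%E ->
  mu2.-integrable setT (EFin \o (fun z => windows l m z * h (z.1 - z.2))).
Proof.
move=> l0 mh hi; have [c c0 hc] := profile_bounded R.
have mf : measurable_fun setT (fun z : R2 => windows l m z * h (z.1 - z.2)).
  exact: (measurable_funM (measurable_windows l m) (measurable_sub2 mh)).
apply/integrable12ltyP; first exact/measurable_EFinP.
have mnh : measurable_fun setT (fun y => `|h y|) by exact: measurableT_comp.
have b := @window_window_le R c l m _ l0 hc mnh (fun y => normr_ge0 (h y)).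
have -> : (\int[mu]_x \int[mu]_y `|(EFin \o (fun z => windows l m z * h (z.1 - z.2))%R) (x, y)| =
  \int[mu]_x \int[mu]_y (window l m x * window l 0 y * `|h (x - y)|)%:E)%E.
  apply: eq_integral => x _; apply: eq_integral => y _.
  rewrite /comp abse_EFin normrM ger0_norm//; exact: (windows_ge0 m (x, y) l0).
apply: (le_lt_trans b); apply: lte_mul_pinfty => //.
by rewrite lee_fin mulr_ge0 ?divr_ge0 ?(ltW c0) ?(ltW l0) ?ltW ?profile_mass_gt0.
Qed.

Lemma Rintegral_windows_sub_le c l m h (B : R) : 0 < l -> (forall s, @profile R s <= c) ->
  measurable_fun setT h -> (forall y, 0 <= h y) ->
  (\int[mu]_(y in ball m (3 * l)) (h y)%:E <= B%:E)%E ->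
  \int[mu2]_z (windows l m z * h (z.1 - z.2)) <= c / l * profile_mass R * B.
Proof.
move=> l0 hc mh h0 hB.
have c0 : 0 <= c by exact: le_trans (profile_ge0 0) (hc 0).
have cl : 0 <= c / l * profile_mass R.
  by rewrite mulr_ge0 ?divr_ge0 ?(ltW l0) ?(ltW (profile_mass_gt0 R)).
have mf : measurable_fun setT (fun z : R2 => windows l m z * h (z.1 - z.2)).
  exact: (measurable_funM (measurable_windows l m) (measurable_sub2 mh)).
have f0 (z : R2) : (0 <= (windows l m z * h (z.1 - z.2))%:E)%E.
  by rewrite lee_fin; apply: mulr_ge0; [exact: windows_ge0|exact: h0].
have b := @window_window_le R c l m _ l0 hc mh h0.
have bB : (\int[mu2]_z (windows l m z * h (z.1 - z.2))%:E <=
    (c / l * profile_mass R * B)%:E)%E.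
  have mfE : measurable_fun setT (fun z : R2 => (windows l m z * h (z.1 - z.2))%:E).
    exact/measurable_EFinP.
  have := @fubini_tonelli1 _ _ _ _ _ mu mu _ mfE f0.
  move=> ->; apply: (le_trans b).
  by rewrite [leRHS]EFinM lee_wpmul2l.
rewrite /Rintegral -lee_fin fineK//.
by rewrite ge0_fin_numE ?integral_ge0// (le_lt_trans bB) ?ltry.
Qed.

(** With [kernel_im], the two real components of the integrand of [bilin] at the packets, as
    functions on the product space so that Fubini and linearity apply. *)
Definition kernel_re (M : R -> R[i]) l m x (z : R2) : R :=
  windows l m z * complex.Re (M (z.1 - z.2)) * cos (2 * pi * (z.1 + z.2) * x) -
  windows l m z * complex.Im (M (z.1 - z.2)) * sin (2 * pi * (z.1 + z.2) * x).

Definition kernel_im (M : R -> R[i]) l m x (z : R2) : R :=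
  windows l m z * complex.Re (M (z.1 - z.2)) * sin (2 * pi * (z.1 + z.2) * x) +
  windows l m z * complex.Im (M (z.1 - z.2)) * cos (2 * pi * (z.1 + z.2) * x).

Lemma measurable_phase2 x :
  measurable_fun setT (fun z : R2 => 2 * pi * (z.1 + z.2) * x).
Proof.
apply: measurable_funM => //; apply: measurable_funM => //.
by apply: measurable_funD; [exact: measurable_fst|exact: measurable_snd].
Qed.

Lemma integrable_mul_bounded (f t : R2 -> R) : mu2.-integrable setT (EFin \o f) ->
  measurable_fun setT t -> (forall z, `|t z| <= 1) ->
  mu2.-integrable setT (EFin \o (fun z => f z * t z)).
Proof.
move=> fi mt t1; apply: (le_integrable _ _ _ fi) => //.
  apply/measurable_EFinP; apply: measurable_funM => //.
  by have /integrableP[/measurable_EFinP] := fi.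
by move=> z _; rewrite /= lee_fin normrM ler_piMr.
Qed.

Lemma integrable_kernel (M : R -> R[i]) l m x : 0 < l ->
  measurable_c M -> locally_integrable_c M ->
  mu2.-integrable setT (EFin \o kernel_re M l m x) /\
  mu2.-integrable setT (EFin \o kernel_im M l m x).
Proof.
move=> l0 [mr mi] lM.
have [ir ii] := lM (m - 3 * l) (m + 3 * l).
have sub : ball m (3 * l) `<=` `[m - 3 * l, m + 3 * l].
  move=> y; rewrite ball_itv /= !in_itv /= => /andP[y1 y2].
  by rewrite !ltW.
have fin h : measurable_fun setT h -> mu.-integrable `[m - 3 * l, m + 3 * l] (EFin \o h) ->
    (\int[mu]_(y in ball m (3 * l)) (`|h y|)%:E < +oo)%E.
  move=> mh hi; have mb : measurable (ball m (3 * l) : set (measurableTypeR R)).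
    exact: measurable_ball.
  have mI : measurable (`[m - 3 * l, m + 3 * l]%classic : set (measurableTypeR R)) by [].
  by have /integrableP[] := integrableS mI mb sub hi.
have jr := integrable_windows_sub l0 mr (fin _ mr ir).
have ji := integrable_windows_sub l0 mi (fin _ mi ii).
have mc : measurable_fun setT (fun z : R2 => cos (2 * pi * (z.1 + z.2) * x)).
  apply: measurableT_comp (measurable_phase2 x).
  by apply: continuous_measurable_fun; exact: continuous_cos.
have ms : measurable_fun setT (fun z : R2 => sin (2 * pi * (z.1 + z.2) * x)).
  apply: measurableT_comp (measurable_phase2 x).
  by apply: continuous_measurable_fun; exact: continuous_sin.
have c1 (z : R2) : `|cos (2 * pi * (z.1 + z.2) * x)| <= 1 by rewrite ler_norml cos_geN1 cos_le1.
have s1 (z : R2) : `|sin (2 * pi * (z.1 + z.2) * x)| <= 1 by rewrite ler_norml sin_geN1 sin_le1.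
split.
- have := integrableB measurableT (integrable_mul_bounded jr mc c1) (integrable_mul_bounded ji ms s1).
  exact: eq_integrable.
- have := integrableD measurableT (integrable_mul_bounded jr ms s1) (integrable_mul_bounded ji mc c1).
  exact: eq_integrable.
Qed.

Lemma complex_kernel_re (w v t : R) (c : R[i]) :
  complex.Re (Complex w 0 * Complex v 0 * c * cexpi t) =
  w * v * complex.Re c * cos t - w * v * complex.Im c * sin t.
Proof. by case: c => a b; rewrite /cexpi /=; ring. Qed.

Lemma complex_kernel_im (w v t : R) (c : R[i]) :
  complex.Im (Complex w 0 * Complex v 0 * c * cexpi t) =
  w * v * complex.Re c * sin t + w * v * complex.Im c * cos t.
Proof. by case: c => a b; rewrite /cexpi /=; ring. Qed.

Lemma bilin_packet (M : R -> R[i]) l m x : 0 < l ->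
  measurable_c M -> locally_integrable_c M ->
  complex.Re (bilin M (packet l m) (packet l 0) x) = \int[mu2]_z kernel_re M l m x z /\
  complex.Im (bilin M (packet l m) (packet l 0) x) = \int[mu2]_z kernel_im M l m x z.
Proof.
move=> l0 mM lM; have [ir ii] := integrable_kernel m x l0 mM lM.
rewrite (Rintegral_prod ir) (Rintegral_prod ii) /bilin /cint /=.
split; apply: eq_Rintegral => xi _; apply: eq_Rintegral => eta _;
  by rewrite (fourier_packet m xi l0) (fourier_packet 0 eta l0) ?complex_kernel_re ?complex_kernel_im.
Qed.

Lemma integrable_windows_dist l m h (B : R) : 0 < l -> measurable_fun setT h ->
  (\int[mu]_(y in ball m (3 * l)) (`|h y - h m|)%:E <= B%:E)%E ->
  mu2.-integrable setT (EFin \o (fun z => windows l m z * `|h (z.1 - z.2) - h m|)).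
Proof.
move=> l0 mh hB.
have mg : measurable_fun setT (fun y => `|h y - h m|).
  by apply: measurableT_comp => //; exact: measurable_funB.
apply: (@integrable_windows_sub l m (fun y => `|h y - h m|) l0 mg).
by under eq_integral do rewrite normr_id; exact: le_lt_trans hB (ltry _).
Qed.

                                                                              
                                                                                  
(** Take [z = zr + i zi] for [M m], [a + i b] for a nearby value of [M], and [C], [s] for the cosine
    and sine of a phase [t]. The right-hand side is [w Re (conj z (a + i b) e^(i t))]. Replacing
    [a + i b] by [z] gives [w |z|^2 C], and the subtracted terms pay for the replacement. *)
Lemma kernel_lower (w zr zi a b C s : R) : 0 <= w -> (w != 0 -> 2^-1 <= C) ->
  `|C| <= 1 -> `|s| <= 1 ->
  (zr ^+ 2 + zi ^+ 2) / 2 * w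
    - (`|zr| + `|zi|) * (w * `|a - zr|) - (`|zr| + `|zi|) * (w * `|b - zi|) <=
  w * ((zr * a + zi * b) * C - (zr * b - zi * a) * s).
Proof.
move=> w0 wC C1 s1; have [->|wn] := eqVneq w 0; first by rewrite !mul0r !mulr0 !subr0.
have {wC} C2 := wC wn.
set e := a - zr; set f := b - zi.
have -> : a = zr + e by rewrite /e; ring.
have -> : b = zi + f by rewrite /f; ring.
have -> : (zr ^+ 2 + zi ^+ 2) / 2 * w - (`|zr| + `|zi|) * (w * `|e|) - (`|zr| + `|zi|) * (w * `|f|) =
   w * ((zr ^+ 2 + zi ^+ 2) * 2^-1 - (`|zr| + `|zi|) * (`|e| + `|f|)) by ring.
rewrite ler_wpM2l//.
have -> : (zr * (zr + e) + zi * (zi + f)) * C - (zr * (zi + f) - zi * (zr + e)) * s =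
  (zr ^+ 2 + zi ^+ 2) * C - (- (zr * e * C) - zi * f * C + zr * f * s - zi * e * s) by ring.
apply: lerB; first by rewrite ler_wpM2l// addr_ge0// sqr_ge0.
have bd (u v t : R) : `|t| <= 1 -> `|u * v * t| <= `|u| * `|v|.
  by move=> t1; rewrite !normrM ler_piMr// mulr_ge0.
have := bd zr e C C1; have := bd zi f C C1; have := bd zr f s s1; have := bd zi e s s1.
rewrite !ler_norml => /andP[? ?] /andP[? ?] /andP[? ?] /andP[? ?].
have -> : (`|zr| + `|zi|) * (`|e| + `|f|) =
  `|zr| * `|e| + `|zi| * `|f| + `|zr| * `|f| + `|zi| * `|e| by ring.
by apply: lerD; [apply: lerD; [apply: lerD|]|]; rewrite // lerNl.
Qed.

(** The modulus of [B] is tested against a complex number [qr + i qi] of bounded size. *)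
Lemma cabs_lower (S qr qi L : R) (B : R[i]) : 0 < S -> `|qr| <= S -> `|qi| <= S ->
  L <= qr * complex.Re B + qi * complex.Im B -> L / (2 * S) <= cabs B.
Proof.
move=> S0 hr hi hL; rewrite ler_pdivrMr ?mulr_gt0// (le_trans hL)//.
have -> : cabs B * (2 * S) = S * cabs B + S * cabs B by ring.
apply: lerD; apply: (le_trans (ler_norm _)); rewrite normrM ler_pM//.
  exact: Re_le_cabs.
exact: Im_le_cabs.
Qed.

Lemma ler_half_sub2 (X u v : R) : u <= X / 8 -> v <= X / 8 -> X / 4 <= X / 2 - u - v.
Proof. lra. Qed.

(** The value at [x] is paired with [M m] rotated by the phase [2 pi m x]. The main term is at least
    [n2 I^2 / 2], with [n2] the squared modulus of [M m] and [I] the mass of a window, and the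
    Lebesgue point property keeps the two errors below [n2 I^2 / 8] each. *)
Lemma bilin_packet_lower (M : R -> R[i]) m :
  measurable_c M -> locally_integrable_c M ->
  lebesgue_pt (fun x => complex.Re (M x)) m ->
  lebesgue_pt (fun x => complex.Im (M x)) m -> M m <> 0 ->
  exists d c l0 : R, [/\ 0 < d, 0 < c, 0 < l0 & forall l x, 0 < l -> l < l0 ->
    0 <= x -> x <= d / l -> c <= cabs (bilin M (packet l m) (packet l 0) x)].
Proof.
move=> mM lM lr li Mm; have [mr mi] := mM.
set zr := complex.Re (M m); set zi := complex.Im (M m).
pose S := `|zr| + `|zi|; pose n2 := zr ^+ 2 + zi ^+ 2; pose I := profile_mass R.
have I0 : 0 < I by exact: profile_mass_gt0.
have [K K0 hK] := profile_bounded R.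
have S0 : 0 < S.
  rewrite lt_neqAle addr_ge0// andbT eq_sym paddr_eq0// !normr_eq0.
  apply/negP => /andP[/eqP z1 /eqP z2]; apply: Mm.
  by move: z1 z2; rewrite /zr /zi; case: (M m) => u v /= -> ->.
have n20 : 0 < n2.
  rewrite lt_neqAle addr_ge0 ?sqr_ge0// andbT eq_sym paddr_eq0 ?sqr_ge0// !sqrf_eq0.
  apply/negP => /andP[/eqP z1 /eqP z2]; move: S0.
  by rewrite /S z1 z2 normr0 addr0 ltxx.
(* Chosen so that [K / l * I * (e * 6 l)], the averaged deviation of [M] from [M m], is exactly
   [n2 I^2 / (8 S)]; the [l] cancels. *)
pose e := n2 * I / (48 * S * K).
have e0 : 0 < e by rewrite divr_gt0 ?mulr_gt0.
have [r1 r10 h1] := lebesgue_pt_le lr e0.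
have [r2 r20 h2] := lebesgue_pt_le li e0.
have [d d0 hd] := cos_near0 R.
have pp := @pi_gt0 R.
(* On the supports the residual frequency is at most [2 l], so [x <= d / (4 pi l)] keeps the phase
   below [d]. The second value is [n2 I^2 / 4] divided by [2 S], as in [cabs_lower]; the third
   ensures [3 l < r1] and [3 l < r2]. *)
exists (d / (4 * pi)), (n2 * I ^+ 2 / (8 * S)), (Num.min r1 r2 / 3).
split; rewrite ?divr_gt0 ?mulr_gt0 ?exprn_gt0 ?lt_min ?r10 ?r20//.
move=> l x l0 ll x0 xl.
have l3 : 3 * l < Num.min r1 r2 by rewrite mulrC -ltr_pdivlMr.
have {l3} [l31 l32] : 3 * l < r1 /\ 3 * l < r2.
  by move: l3; rewrite lt_min => /andP[].
have l30 : 0 < 3 * l by rewrite mulr_gt0.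
have b1 := h1 _ l30 l31; have b2 := h2 _ l30 l32.
have j1 := integrable_windows_dist l0 mr b1.
have j2 := integrable_windows_dist l0 mi b2.
have mg h : measurable_fun setT h -> measurable_fun setT (fun y => `|h y - h m|).
  by move=> mh; apply: measurableT_comp => //; exact: measurable_funB.
have E1 := Rintegral_windows_sub_le l0 hK (mg _ mr) (fun y => normr_ge0 _) b1.
have E2 := Rintegral_windows_sub_le l0 hK (mg _ mi) (fun y => normr_ge0 _) b2.
have Ee : K / l * profile_mass R * (e * (3 * l *+ 2)) = n2 * I ^+ 2 / (8 * S).
  by rewrite -mulr_natl /e -/I; field; rewrite !gt_eqF.
rewrite {}Ee in E1 E2.
have [Br Bi] := bilin_packet m x l0 mM lM.
have [ir ii] := integrable_kernel m x l0 mM lM.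
set B := bilin _ _ _ _ in Br Bi *.
pose al := 2 * pi * m * x.
(* [qr + i qi] is [M m] times [e^(i al)], which removes the carrier phase from the pairing. *)
pose qr := zr * cos al - zi * sin al; pose qi := zr * sin al + zi * cos al.
have ck t : `|cos t| <= 1 :> R by rewrite ler_norml cos_geN1 cos_le1.
have sk t : `|sin t| <= 1 :> R by rewrite ler_norml sin_geN1 sin_le1.
have qrS : `|qr| <= S.
  by rewrite (le_trans (ler_normB _ _))// lerD// normrM ler_piMr.
have qiS : `|qi| <= S.
  by rewrite (le_trans (ler_normD _ _))// lerD// normrM ler_piMr.
have lower : n2 * I ^+ 2 / 4 <= qr * complex.Re B + qi * complex.Im B.
  have iw := integrable_windows m l0.
  have ZI (k : R) (f : R2 -> R) : mu2.-integrable setT (EFin \o f) ->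
      mu2.-integrable setT (EFin \o (fun z => k * f z)).
    move=> fi; have := integrableZl measurableT k fi.
    exact: eq_integrable.
  have BI (f g : R2 -> R) : mu2.-integrable setT (EFin \o f) ->
      mu2.-integrable setT (EFin \o g) ->
      mu2.-integrable setT (EFin \o (fun z => f z - g z)).
    by move=> fi gi; have := integrableB measurableT fi gi; exact: eq_integrable.
  have DI (f g : R2 -> R) : mu2.-integrable setT (EFin \o f) ->
      mu2.-integrable setT (EFin \o g) ->
      mu2.-integrable setT (EFin \o (fun z => f z + g z)).
    by move=> fi gi; have := integrableD measurableT fi gi; exact: eq_integrable.
  rewrite Br Bi -!RintegralZl// -RintegralD//; [|exact: ZI|exact: ZI].
  apply: (@le_trans _ _ (\int[mu2]_z (n2 / 2 * windows l m z
      - S * (windows l m z * `|complex.Re (M (z.1 - z.2)) - zr|)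
      - S * (windows l m z * `|complex.Im (M (z.1 - z.2)) - zi|)))).
    rewrite RintegralB//; [|by apply: BI; exact: ZI|exact: ZI].
    rewrite RintegralB//; [|exact: ZI|exact: ZI].
    rewrite !RintegralZl// (Rintegral_windows m l0) -/I.
    have S1 := ler_wpM2l (ltW S0) E1; have S2 := ler_wpM2l (ltW S0) E2.
    have SE : S * (n2 * I ^+ 2 / (8 * S)) = n2 * I ^+ 2 / 8.
      by field; rewrite gt_eqF.
    rewrite {}SE in S1 S2.
    have -> : n2 / 2 * I ^+ 2 = n2 * I ^+ 2 / 2 by rewrite mulrAC.
    exact: (ler_half_sub2 S1 S2).
  apply: le_Rintegral => //.
  - by apply: (BI); [apply: (BI); exact: ZI|exact: ZI].
  - by apply: DI; exact: ZI.
  move=> z _.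
  pose th := 2 * pi * (z.1 - m + z.2) * x.
  have phE : 2 * pi * (z.1 + z.2) * x = th + al by rewrite /th /al; ring.
  have -> : qr * kernel_re M l m x z + qi * kernel_im M l m x z =
    windows l m z * ((zr * complex.Re (M (z.1 - z.2)) + zi * complex.Im (M (z.1 - z.2))) * cos th
      - (zr * complex.Im (M (z.1 - z.2)) - zi * complex.Re (M (z.1 - z.2))) * sin th).
    have -> : th = 2 * pi * (z.1 + z.2) * x - al by rewrite phE addrK.
    rewrite cosB sinB /kernel_re /kernel_im /qr /qi.
    move: (windows _ _ _) (cos al) (sin al) (cos _) (sin _) => *; ring.
  apply: kernel_lower => //; first exact: windows_ge0.
  move=> wn; apply: hd.
  have z1 : `|m - z.1| <= l.
    rewrite leNgt; apply/negP => h; move/negP: wn; apply.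
    by rewrite /windows (window_out l0 h) mul0r.
  have z2 : `|0 - z.2| <= l.
    rewrite leNgt; apply/negP => h; move/negP: wn; apply.
    by rewrite /windows (window_out l0 h) mulr0.
  have z12 : `|z.1 - m + z.2| <= 2 * l.
    rewrite mulr_natl mulr2n (le_trans (ler_normD _ _))// lerD//; first by rewrite distrC.
    by rewrite sub0r normrN in z2.
  rewrite /th !normrM (gtr0_norm pp) (ger0_norm x0) ger0_norm//.
  rewrite (@le_trans _ _ (2 * pi * (2 * l) * (d / (4 * pi) / l)))//.
    by rewrite ler_pM ?mulr_ge0 ?(ltW pp)// ler_wpM2l// mulr_ge0 ?(ltW pp).
  rewrite le_eqVlt; apply/orP; left; apply/eqP.
  move: pp; move: pi => p pp; field; rewrite !gt_eqF//.
have := cabs_lower S0 qrS qiS lower.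
have -> // : n2 * I ^+ 2 / 4 / (2 * S) = n2 * I ^+ 2 / (8 * S).
by field; rewrite gt_eqF.
Qed.

End BilinearLowerBound.

                   

(** * Comparison of the two bounds as the bandwidth shrinks *)

Section Conclusion.
Variable R : realType.
Local Notation mu := (@lebesgue_measure R).

Import HBNNSimple.

                                                                             
(** The integral is a supremum over simple functions below [f], and [k] times the indicator of [A]
    is one of them. In this form the bound applies directly to powers of the modulus of [bilin]. *)
Lemma cst_measure_le_integral (f : R -> \bar R) (A : set (measurableTypeR R)) (k : R) :
  measurable A -> 0 <= k -> (forall x, 0 <= f x)%E -> (forall x, A x -> k%:E <= f x)%E ->
  (k%:E * mu A <= \int[mu]_x f x)%E.
Proof.
move=> mA k0 f0 kf.
pose g : {nnsfun measurableTypeR R >-> R} := scale_nnsfun (indic_nnsfun R mA) k0.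
have gE x : g x = k * \1_A x by [].
have -> : (k%:E * mu A = sintegral mu g)%E.
  rewrite -integralT_nnsfun -[in LHS](setIT A) -integral_indic//.
  rewrite -ge0_integralZl_EFin//.
  by apply/measurable_EFinP; exact: measurable_indic.
rewrite ge0_integralTE//; apply: ereal_sup_ubound => /=; exists g => // x.
rewrite gE indicE; have [|_] := boolP (x \in A); last by rewrite mulr0 f0.
by rewrite inE mulr1; exact: kf.
Qed.

Lemma Lpnorm_ge (f : R -> R[i]) (r c T : R) : 0 < r -> 0 <= c -> 0 < T ->
  (forall x, 0 <= x -> x <= T -> c <= cabs (f x)) ->
  ((c * T `^ r^-1)%:E <= Lpnorm r%:E f)%E.
Proof.
move=> r0 c0 T0 cf; rewrite /Lpnorm unlock.
have cr : c * T `^ r^-1 = (c `^ r * T) `^ r^-1.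
  by rewrite powRM ?powR_ge0 ?(ltW T0)// -powRrM divff ?gt_eqF// powRr1.
have mA : measurable (`[0, T]%classic : set (measurableTypeR R)) by [].
have cT : ((c `^ r * T)%:E <= \int[mu]_x (`|(cabs (f x))%:E| `^ r))%E.
  have := @cst_measure_le_integral (fun x => `|(cabs (f x))%:E| `^ r)%E
    `[0, T]%classic (c `^ r) mA (powR_ge0 _ _).
  rewrite /= lebesgue_measure_itv/= lte_fin T0 oppr0 adde0 -EFinM; apply.
    by move=> x; rewrite lee_fin powR_ge0.
  move=> x; rewrite /= in_itv /= => /andP[x0 xT].
  rewrite lee_fin; apply: ge0_ler_powR; rewrite ?nnegrE ?(ltW r0)//.
  by rewrite (le_trans (cf x x0 xT))// ler_norm.
rewrite cr -poweR_EFin; apply: gt0_ler_poweR => //.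
- by rewrite invr_ge0 ltW.
- by rewrite in_itv /= leey andbT lee_fin mulr_ge0 ?powR_ge0 ?(ltW T0).
- by rewrite in_itv /= leey andbT integral_ge0// => x _; rewrite lee_fin powR_ge0.
Qed.

Lemma locally_integrable_itv (h : R -> R) : measurable_fun setT h ->
  (forall a b : R, mu.-integrable `[a, b] (fun x => (h x)%:E)) ->
  locally_integrable setT h.
Proof.
move=> mh hi; split => //; first exact: openT.
move=> K _ cK; have [A [_ KA]] := compact_bounded cK.
have KA1 : K `<=` `[- (A + 1), A + 1].
  move=> x Kx /=; rewrite in_itv /= -ler_norml.
  by apply: (KA (A + 1)) => //; rewrite ltrDl.
have /integrableP[_ hfin] := hi (- (A + 1)) (A + 1).
apply: le_lt_trans hfin; apply: ge0_subset_integral => //=.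
- exact: compact_measurable.
- by apply/measurable_EFinP; apply: measurableT_comp => //; exact: measurable_funS mh.
Qed.

Lemma Mtilde_zero (p1 p2 p3 : \bar R) : (1 <= p3)%E -> Mtilde p1 p2 p3 (fun _ => 0).
Proof.
move=> p31; split; first by split; exact: measurable_cst.
split.
  by move=> a b; split; exact: integrable0.
exists 0 => f g _ _; rewrite mul0e.
have -> : bilin (fun _ => 0) f g = fun _ => 0.
  apply/funext => x; rewrite /bilin.
  have z0 : cint (fun _ : R => 0 : R[i]) = 0.
    by rewrite /cint /= /Rintegral integral0.
  rewrite -[RHS]z0; congr cint; apply/funext => xi; rewrite -[RHS]z0; congr cint.
  by apply/funext => eta; rewrite mulr0 mul0r.
rewrite /Lpnorm.
have -> : (fun _ : measurableTypeR R => (cabs (0 : R[i]))%:E) = cst 0%E.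
  by apply/funext => x; rewrite /cabs /= expr0n addr0 sqrtr0.
by rewrite Lnorm0// gt_eqF// (lt_le_trans _ p31)// lte_fin.
Qed.

Lemma powR_unbounded (c K g l0 : R) : 0 < c -> 0 <= K -> 0 < g -> 0 < l0 ->
  exists l, [/\ 0 < l, l < l0 & K * l `^ g < c].
Proof.
move=> c0 K0 g0 l00.
pose y := c / (K + 1).
have K1 : 0 < K + 1 by rewrite ltr_wpDl.
have y0 : 0 < y by rewrite divr_gt0.
(* The second entry gives [l^g <= y], and [K * y < c] because [y] was defined with [K + 1]. *)
pose l := Num.min (l0 / 2) (y `^ g^-1).
have l_gt0 : 0 < l by rewrite lt_min divr_gt0// powR_gt0.
exists l; split => //.
  by rewrite (@le_lt_trans _ _ (l0 / 2)) ?ge_min ?lexx// ltr_pdivrMr// ltr_pMr// ltr1n.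
have ly : l `^ g <= y.
  have gn : g != 0 by rewrite gt_eqF.
  rewrite -[leRHS]powRr1 ?(ltW y0)// -(mulVf gn) powRrM.
  apply: ge0_ler_powR; rewrite ?nnegrE ?(ltW g0) ?(ltW l_gt0) ?powR_ge0//.
  by rewrite ge_min lexx orbT.
rewrite (le_lt_trans (ler_wpM2l K0 ly))// /y mulrCA gtr_pMr//.
by rewrite ltr_pdivrMr// mul1r ltrDl.
Qed.

(** If [M m] were nonzero, both bounds would hold for all small [l], giving [c d^(1/p3) <= K l^g]
    with [g] the positive gap between the exponents, which fails for small [l]. *)
Lemma Mtilde_lebesgue_pt_eq0 (p1 p2 p3 : \bar R) (M : R -> R[i]) m :
  (1 <= p1)%E -> (1 <= p2)%E -> (1 <= p3)%E ->
  inv_exp p1 + inv_exp p2 < inv_exp p3 -> Mtilde p1 p2 p3 M ->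
  lebesgue_pt (fun x => complex.Re (M x)) m ->
  lebesgue_pt (fun x => complex.Im (M x)) m -> M m = 0.
Proof.
move=> p11 p21 p31 pp [mM [lM [C hC]]] lr li.
apply: contrapT => Mm.
have [d [c [l0 [d0 c0 l00 hB]]]] := bilin_packet_lower mM lM lr li Mm.
have ip (p : \bar R) : (1 <= p)%E -> 0 <= inv_exp p.
  by case: p => [s|//|//]; rewrite lee_fin /= invr_ge0 => /(le_trans ler01).
(* An infinite [p3] has [inv_exp p3 = 0], which cannot exceed a sum of nonnegative terms. *)
have [r r1 rE] : exists2 r : R, 1 <= r & p3 = r%:E.
  move: p31 pp; case: p3 {hC} => [s s1 _|_|//]; first by exists s.
  by rewrite /= ltNge addr_ge0// ip.
have r0 : 0 < r by exact: lt_le_trans ltr01 r1.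
have [c1 c10 h1] := Lpnorm_packet p11; have [c2 c20 h2] := Lpnorm_packet p21.
pose g := inv_exp p3 - (inv_exp p1 + inv_exp p2).
have g0 : 0 < g by rewrite subr_gt0.
have cd : 0 < c * d `^ r^-1 by rewrite mulr_gt0// powR_gt0.
have K0 : 0 <= `|C| * (c1 * c2) by rewrite mulr_ge0// mulr_ge0// ltW.
have [l [l_gt0 ll0 hl]] := powR_unbounded cd K0 g0 l00.
have lowr : ((c * (d / l) `^ r^-1)%:E <= Lpnorm p3 (bilin M (packet l m) (packet l 0%R)))%E.
  rewrite rE; apply: Lpnorm_ge => //; [exact: ltW|exact: divr_gt0|].
  by move=> x x0 xd; exact: hB.
have uppr : (Lpnorm p3 (bilin M (packet l m) (packet l 0%R)) <=
    (`|C| * ((c1 * l `^ (- inv_exp p1)) * (c2 * l `^ (- inv_exp p2))))%:E)%E.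
  apply: (le_trans (hC _ _ (packet_classP m l_gt0) (packet_classP 0 l_gt0))).
  have n0 (p : \bar R) f : (0 <= Lpnorm p f)%E by exact: Lnorm_ge0.
  (* The constant [C] may be negative, so its absolute value is used before the norms are
     bounded. *)
  apply: (@le_trans _ _ (`|C|%:E * (Lpnorm p1 (packet l m) * Lpnorm p2 (packet l 0%R))))%E.
    by apply: lee_wpmul2r; [exact: mule_ge0|rewrite lee_fin ler_norm].
  rewrite [leRHS]EFinM; apply: lee_wpmul2l; first by rewrite lee_fin.
  by rewrite [leRHS]EFinM; apply: lee_pmul => //; [exact: h1|exact: h2].
have := le_trans lowr uppr; rewrite lee_fin => h.
have lr0 : 0 < l `^ r^-1 by exact: powR_gt0.
move: h; rewrite powRM ?invr_ge0 ?(ltW d0) ?(ltW l_gt0)//.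
have -> : l^-1 `^ r^-1 = (l `^ r^-1)^-1.
  by rewrite -[l^-1]powR_inv1 ?(ltW l_gt0)// -powRrM mulN1r powRN.
rewrite mulrA ler_pdivrMr// leNgt => /negP; apply.
suff -> : `|C| * (c1 * l `^ (- inv_exp p1) * (c2 * l `^ (- inv_exp p2))) * l `^ r^-1 =
  `|C| * (c1 * c2) * l `^ g by [].
have ln : l != 0 by rewrite gt_eqF.
rewrite /g rE /= opprD !powRD ?ln ?implybT//; ring.
Qed.

End Conclusion.

Theorem mainTheorem10 (R : realType) (p1 p2 p3 : \bar R) :
  (1 <= p1)%E -> (1 <= p2)%E -> (1 <= p3)%E ->
  inv_exp p1 + inv_exp p2 < inv_exp p3 ->
  Mtilde p1 p2 p3 (fun _ => 0) /\
  (forall M : R -> R[i], Mtilde p1 p2 p3 M ->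
     {ae (@lebesgue_measure R), forall x, M x = 0}).
Proof.
move=> p11 p21 p31 pp; split; first exact: Mtilde_zero.
move=> M hM; have [[mr mi] [lM _]] := hM.
(* Lebesgue differentiation is applied to the real and imaginary parts separately; the two
   full-measure sets are then intersected. *)
have lr := lebesgue_differentiation (locally_integrable_itv mr (fun a b => (lM a b).1)).
have li := lebesgue_differentiation (locally_integrable_itv mi (fun a b => (lM a b).2)).
have F : Filter (almost_everywhere (@lebesgue_measure R)).
  exact: (ae_filter_ringOfSetsType (lebesgue_measure_lebesgue_measure__canonical__measure_function_Measure R)).
apply: (@filterS2 _ _ F _ _ _ _ lr li) => m lrm lim.
exact: (Mtilde_lebesgue_pt_eq0 p11 p21 p31 pp hM lrm lim).
Qed.
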